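(* Let $\Gamma$ be a finite simplicial graph. If $W_\Gamma$ has hypergraph index $h$ with $0<h<\infty$, then $W_\Gamma$ is algebraically thick of order at most $2h-1$.
   Context: Graphs are finite and simplicial. $W_\Gamma=\langle V(\Gamma)\mid s^2=1\ (s\in V(\Gamma)),\ st=ts\ ((s,t)\in E(\Gamma))\rangle$, with the word metric (Cayley graph) for $V(\Gamma)$. A graph is a join $A\star B$ if its vertex set is $V(A)\cup V(B)$ and every vertex of $A$ is adjacent to every vertex of $B$. A clique is a graph in which any two distinct vertices are adjacent. Hypergraph index. $\Omega(\Gamma)$ (wide subgraphs) is the set of induced subgraphs $L=A\star B$ of $\Gamma$, with $A,B$ induced subgraphs each containing a pair of non-adjacent vertices, that are maximal under inclusion among such subgraphs. $\Psi(\Gamma)$ (strip subgraphs) is the set of induced subgraphs $L=A\star K$, with $A$ two non-adjacent vertices and $K$ a non-empty clique, that are not properly contained in an element of $\Omega(\Gamma)$ or in another induced subgraph of this same form. The hypergraphs $\Lambda_i=\Lambda_i(\Gamma)$, $i\ge0$, have vertex set $V(\Gamma)$. The hyperedges of $\Lambda_0$ are the sets $V(L)$, $L\in\Omega(\Gamma)\cup\Psi(\Gamma)$. For hyperedges of $\Lambda_i$ put $H\equiv_iH'$ if there are hyperedges $H=H_0,\dots,H_n=H'$ of $\Lambda_i$ such that each $H_j\cap H_{j+1}$ ($0\le j<n$) contains a pair of non-adjacent vertices. The hyperedges of $\Lambda_{i+1}$ are the unions of the hyperedges in the $\equiv_i$-classes. $W_\Gamma$ has hypergraph index $h\in\{0,1,2,\dots\}$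 if $\Omega(\Gamma)\ne\emptyset$, some hyperedge of $\Lambda_h$ contains every vertex of $\Gamma$, and no hyperedge of $\Lambda_{h-1}$ does (void if $h=0$). Otherwise the hypergraph index is $\infty$. Algebraic thickness. $N_C(Y)$ is the $C$-neighborhood of $Y$. A subset $Y$ is $C$-path connected if any two of its points are joined by a path in $N_C(Y)$. A finitely generated group is wide if none of its asymptotic cones has a cut-point and every point of its Cayley graph is uniformly near a bi-infinite $(L,L)$-quasi-geodesic for some fixed $L$. A subgroup $H$ is $C$-quasi-convex if any two of its points are joined by a $(C,C)$-quasi-geodesic in $N_C(H)$ (in the Cayley graph). For $C>0$, $G$ is a $C$-tight algebraic network with respect to a set $\mathcal H$ of subgroups if: (a) each $H\in\mathcal H$ is $C$-quasi-convex; (b) the union of the subgroups in $\mathcal H$ generates a finite index subgroup of $G$; (c) for all $H,H'\in\mathcal H$ there is a sequence $H=H_1,\dots,H_n=H'$ in $\mathcal H$ such that $H_i\cap H_{i+1}$ is infinite and $C$-path connected for $1\le i<n$. $G$ is algebraically thick of order (at most) $0$ if it is wide. For $k\ge1$, $G$ is algebraically thick of order at most $k$ if for some $C$ and some finite collection $\mathcal H$ of subgroups, $G$ is a $C$-tight algebraic network with respect to $\mathcal H$ and every $H\in\mathcal H$ is algebraically thick of order at most $k-1$. *)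

(* Defs.v *)
From HB Require Import structures.
From mathcomp Require Import all_boot all_order all_algebra.

Set Implicit Arguments.
Unset Strict Implicit.
Unset Printing Implicit Defensive.

Record sgraph := SGraph {
  vertex :> finType;
  adj : rel vertex;
  adj_sym : symmetric adj;
  adj_irr : irreflexive adj
}.

(* Induced subgraphs are represented by their vertex sets. *)
Section HypergraphIndex.
Variable G : sgraph.
Implicit Types A B K L H : {set G}.

Definition has_nonadj A :=
  [exists s in A, exists t in A, (s != t) && ~~ adj s t].

Definition clique K := [forall s in K, forall t in K, (s != t) ==> adj s t].

(* [L] is the join of [A] and [B]; as [adj] is irreflexive, [A] and [B] are
   then disjoint. *)
Definition is_join L A B :=
  (L == A :|: B) && [forall s in A, forall t in B, adj s t].

Definition nonadj_join L :=
  [exists A, exists B, [&& is_join L A B, has_nonadj A & has_nonadj B]].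

Definition Omega : {set {set G}} := [set L | maxset nonadj_join L].

Definition suspended_clique L :=
  [exists s, exists t, exists K,
    [&& s != t, ~~ adj s t, K != set0, clique K & is_join L [set s; t] K]].

Definition Psi : {set {set G}} :=
  [set L | [&& suspended_clique L,
      [forall M in Omega, ~~ (L \proper M)]
    & [forall M, suspended_clique M ==> ~~ (L \proper M)]]].

Section Step.
Variable E : {set {set G}}.

Definition meets_nonadj : rel {set G} :=
  [rel H H' | [&& H \in E, H' \in E & has_nonadj (H :&: H')]].

Definition equiv_class H : {set {set G}} :=
  [set H' in E | connect meets_nonadj H H'].

Definition merge_hyperedges : {set {set G}} :=
  [set cover (equiv_class H) | H in E].

End Step.

Fixpoint Lambda (i : nat) : {set {set G}} :=
  if i is j.+1 then merge_hyperedges (Lambda j) else Omega :|: Psi.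

Definition has_full_hyperedge (i : nat) := [exists H in Lambda i, H == setT].

Definition has_hypergraph_index (h : nat) : bool :=
  [&& Omega != set0, has_full_hyperedge h
    & if h is i.+1 then ~~ has_full_hyperedge i else true].

End HypergraphIndex.

(* The classical sets are imported only now: they shadow the names and notations
   of the finite sets used above. *)
From mathcomp Require Import all_classical all_reals all_analysis.

Import Order.TTheory GRing.Theory Num.Theory.
Import numFieldNormedType.Exports.

Section Subgroups.
Local Open Scope group_scope.
Local Open Scope classical_set_scope.
Variable G : groupType.

Definition is_subgroup (H : set G) :=
  H 1 /\ (forall x y, H x -> H y -> H (x / y)).

Definition generated (A : set G) : set G := smallest is_subgroup A.

Definition finite_index (H : set G) :=
  exists2 F : set G, finite_set F & forall x, exists f h,
    [/\ F f, H h & x = f * h].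

Definition is_word (S : set G) (w : seq G) := forall x, x \in w -> S x \/ S x^-1.

End Subgroups.

Record fg_group := FgGroup {
  fg_carrier :> groupType;
  fg_gens : set fg_carrier;
  fg_gens_finite : finite_set fg_gens;
  fg_gensP : generated fg_gens = setT
}.

Section WordMetric.
Local Open Scope group_scope.
Local Open Scope classical_set_scope.
Variable G : fg_group.
Implicit Types (x y z : G) (w : seq G).

Definition is_word_of x (n : nat) := exists w : seq G,
  [/\ size w = n, is_word (@fg_gens G) w & x = \prod_(s <- w) s].

Lemma is_word_of1 : is_word_of 1 0.
Proof. by exists [::]; split=> //; rewrite big_nil. Qed.

Lemma is_word_ofM x y m n :
  is_word_of x m -> is_word_of y n -> is_word_of (x * y) (m + n).
Proof.
move=> [u [<- uS ->]] [v [<- vS ->]]; exists (u ++ v).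
split; rewrite ?size_cat ?big_cat // => z.
by rewrite mem_cat => /orP[/uS|/vS].
Qed.

Lemma is_word_ofV x n : is_word_of x n -> is_word_of x^-1 n.
Proof.
move=> [w [<-]]; elim: w x => [|s w IH] x wS ->.
  by exists [::]; split; rewrite ?big_nil ?invg1.
have wS' : is_word (@fg_gens G) w by move=> z zw; apply: wS; rewrite inE zw orbT.
rewrite big_cons invgM /= -addn1; apply: is_word_ofM; first exact: IH.
exists [:: s^-1]; split; rewrite ?big_seq1 // => z; rewrite inE => /eqP ->.
by rewrite invgK or_comm; apply: wS; rewrite inE eqxx.
Qed.

Lemma word_exists x : exists n, `[< is_word_of x n >].
Proof.
suff: [set x | exists n, is_word_of x n] x by move=> [n nx]; exists n; apply/asboolP.
have : generated (@fg_gens G) x by rewrite fg_gensP.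
apply: smallest_sub; last first.
  move=> s Ss; exists 1%N, [:: s]; split; rewrite ?big_seq1 // => z.
  by rewrite inE => /eqP ->; left.
split; first by exists 0; exact: is_word_of1.
move=> y z [m ym] [n zn]; exists (m + n)%N.
by apply: is_word_ofM => //; apply: is_word_ofV.
Qed.

Definition word_length x : nat := ex_minn (word_exists x).

Definition word_dist x y : nat := word_length (x^-1 * y).

Lemma word_lengthP x : is_word_of x (word_length x).
Proof. by rewrite /word_length; case: ex_minnP => n /asboolP. Qed.

Lemma word_length_min x n : is_word_of x n -> (word_length x <= n)%N.
Proof.
by move=> xn; rewrite /word_length; case: ex_minnP => m _; apply; apply/asboolP.
Qed.

Lemma word_distxx x : word_dist x x = 0.
Proof.
apply/eqP; rewrite -leqn0 word_length_min // mulVg; exact: is_word_of1.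
Qed.

Lemma word_dist0 x y : word_dist x y = 0 -> x = y.
Proof.
rewrite /word_dist => d0; have := word_lengthP (x^-1 * y); rewrite d0.
move=> [[|a w] [// _ _]]; rewrite big_nil => xy.
by rewrite -[y](mulVKg x) xy mulg1.
Qed.

Lemma word_dist_sym x y : word_dist x y = word_dist y x.
Proof.
suff le u v : (word_dist u v <= word_dist v u)%N by apply/eqP; rewrite eqn_leq !le.
apply: word_length_min; rewrite (_ : u^-1 * v = (v^-1 * u)^-1).
  exact/is_word_ofV/word_lengthP.
by rewrite invgM invgK.
Qed.

Lemma word_dist_triangle y x z :
  (word_dist x z <= word_dist x y + word_dist y z)%N.
Proof.
apply: word_length_min; rewrite (_ : x^-1 * z = (x^-1 * y) * (y^-1 * z)).
  by apply: is_word_ofM; apply: word_lengthP.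
by rewrite mulgA mulgK.
Qed.

End WordMetric.

(* The vertex set of the Cayley graph of [G] with its path metric. It stands for
   the Cayley graph below: the two are at Hausdorff distance at most 1/2, so they
   have the same asymptotic cones and the same quasi-geodesics and neighborhoods
   up to a change of the constants, which are always quantified existentially. *)
Definition cayley (R : realType) (G : fg_group) : Type := G.

Section Cayley.
Local Open Scope ring_scope.
Variables (R : realType) (G : fg_group).
Local Notation X := (cayley R G).

HB.instance Definition _ := Choice.copy X G.

Let dist (x y : X) : R := (@word_dist G x y)%:R.

Let distxx x : dist x x = 0.
Proof. by rewrite /dist word_distxx. Qed.

Let dist_positivity x y : dist x y = 0 -> x = y.
Proof. by move/eqP; rewrite /dist pnatr_eq0 => /eqP /word_dist0. Qed.

Let dist_sym x y : dist x y = dist y x.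
Proof. by rewrite /dist word_dist_sym. Qed.

Let dist_triangle y x z : dist x z <= dist x y + dist y z.
Proof. by rewrite /dist -natrD ler_nat; apply: word_dist_triangle. Qed.

HB.instance Definition _ :=
  isMetric.Build R X distxx dist_positivity dist_sym dist_triangle.

End Cayley.

(* A non-principal ultrafilter, observation points and scaling constants. *)
Record cone_data (R : realType) (X : metricType R) := ConeData {
  cone_filter : set_system nat;
  cone_ultra : UltraFilter cone_filter;
  cone_nonprincipal : forall n, ~ cone_filter [set n]%classic;
  cone_base : nat -> X;
  cone_scale : nat -> R;
  cone_scale_gt0 : forall n, (0 < cone_scale n)%R;
  cone_scale_cvg : (cone_scale @ cone_filter --> +oo%R)%classic
}.

Section AsymptoticCone.
Local Open Scope ring_scope.
Local Open Scope classical_set_scope.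
Local Open Scope quotient_scope.
Variables (R : realType) (X : metricType R) (D : cone_data X).
Local Notation omega := (cone_filter D).
Local Notation s := (cone_scale D).
#[local] Instance omega_ultra : UltraFilter omega := cone_ultra D.

Definition rescaled (x y : nat -> X) : nat -> R :=
  fun n => mdist (x n) (y n) / s n.

Definition cone_seq := {x : nat -> X |
  `[< exists M, \forall n \near omega, rescaled x (cone_base D) n <= M >]}.

Definition cone_dist (x y : cone_seq) : R := lim (rescaled (val x) (val y) @ omega).

Let rescaled_ge0 x y n : 0 <= rescaled x y n.
Proof. by rewrite divr_ge0 ?mdist_ge0 // ltW // cone_scale_gt0. Qed.

Let rescaled_sym x y : rescaled x y = rescaled y x.
Proof. by apply/funext => n; rewrite /rescaled metric_sym. Qed.

Let rescaled_triangle y x z n :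
  rescaled x z n <= rescaled x y n + rescaled y z n.
Proof.
rewrite /rescaled -mulrDl ler_pM2r ?invr_gt0 ?cone_scale_gt0 //.
exact: metric_triangle.
Qed.

Lemma cone_cvg (x y : cone_seq) : cvg (rescaled (val x) (val y) @ omega).
Proof.
have /asboolP [M xM] := valP x; have /asboolP [N yN] := valP y.
have xyMN : \forall n \near omega, `[0, M + N] (rescaled (val x) (val y) n).
  near=> n; rewrite /= in_itv /=; apply/andP; split; first exact: rescaled_ge0.
  apply: (le_trans (rescaled_triangle (cone_base D) _ _ _)).
  rewrite lerD //; last by rewrite rescaled_sym; near: n.
  by near: n.
have UF : UltraFilter (rescaled (val x) (val y) @ omega).
  split=> [|F PF sF]; first exact: fmap_proper_filter.
  apply/seteqP; split=> // A FA; have [//|nA] :=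
    in_ultra_setVsetC (rescaled (val x) (val y) @^-1` A) (cone_ultra D).
  have FAA : F (A `&` ~` A) by apply: filterI => //; exact: (sF (~` A) nA).
  have [z [Az nAz]] := filter_ex FAA.
  by case: (nAz Az).
have := @segment_compact R 0 (M + N); rewrite compact_ultra.
by move=> /(_ _ UF xyMN) [l [_ xyl]]; apply/cvg_ex; exists l.
Unshelve. all: by end_near. Qed.

Lemma cone_dist_triangle (y x z : cone_seq) :
  cone_dist x z <= cone_dist x y + cone_dist y z.
Proof.
rewrite /cone_dist -limD; [|exact: cone_cvg|exact: cone_cvg].
apply: ler_lim; [exact: cone_cvg|by apply: is_cvgD; apply: cone_cvg|].
by apply: nearW => n; apply: rescaled_triangle.
Qed.

Lemma cone_distxx (x : cone_seq) : cone_dist x x = 0.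
Proof.
rewrite /cone_dist (_ : rescaled _ _ = cst 0); first exact: lim_cst.
by apply/funext => n; rewrite /rescaled mdistxx mul0r.
Qed.

Lemma cone_dist_sym (x y : cone_seq) : cone_dist x y = cone_dist y x.
Proof. by rewrite /cone_dist rescaled_sym. Qed.

Lemma cone_dist_ge0 (x y : cone_seq) : 0 <= cone_dist x y.
Proof. by apply: limr_ge; [exact: cone_cvg|exact: nearW]. Qed.

Definition cone_eq : rel cone_seq := fun x y => cone_dist x y == 0.

Lemma cone_eq_equiv : equiv_class_of cone_eq.
Proof.
split=> [x|x y|y x z]; first by rewrite /cone_eq cone_distxx.
  by rewrite /cone_eq cone_dist_sym.
rewrite /cone_eq => /eqP xy /eqP yz; rewrite eq_le cone_dist_ge0 andbT.
by apply: (le_trans (cone_dist_triangle y x z)); rewrite xy yz addr0.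
Qed.

Canonical cone_eq_equiv_rel := EquivRelPack cone_eq_equiv.

Definition asymptotic_cone := {eq_quot cone_eq}.

HB.instance Definition _ := Choice.on asymptotic_cone.

Let dist (x y : asymptotic_cone) : R := cone_dist (repr x) (repr y).

Let distxx x : dist x x = 0.
Proof. exact: cone_distxx. Qed.

Let dist_positivity x y : dist x y = 0 -> x = y.
Proof. by move/eqP=> xy; rewrite -(reprK x) -(reprK y); apply/eqP; rewrite piE. Qed.

Let dist_sym x y : dist x y = dist y x.
Proof. exact: cone_dist_sym. Qed.

Let dist_triangle y x z : dist x z <= dist x y + dist y z.
Proof. exact: cone_dist_triangle. Qed.

HB.instance Definition _ :=
  isMetric.Build R asymptotic_cone distxx dist_positivity dist_sym dist_triangle.

End AsymptoticCone.

Definition cut_point (X : topologicalType) (p : X) := ~ connected [set~ p]%classic.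

Section Coarse.
Local Open Scope ring_scope.
Local Open Scope classical_set_scope.
Variables (R : realType) (X : metricType R).
Implicit Types (Y : set X) (c : R -> X) (I : set R).

Definition nbhd (C : R) Y : set X := [set x | exists2 y, Y y & mdist x y <= C].

Definition quasi_geodesic (L A : R) I c :=
  forall t u, I t -> I u ->
    L^-1 * `|t - u| - A <= mdist (c t) (c u) /\
    mdist (c t) (c u) <= L * `|t - u| + A.

Definition joined_by_quasi_geodesic (C : R) Y (x y : X) :=
  exists a b c, [/\ a <= b, c a = x, c b = y,
    quasi_geodesic C C `[a, b] c & c @` `[a, b] `<=` Y].

Definition quasi_convex (C : R) Y := forall x y, Y x -> Y y ->
  joined_by_quasi_geodesic C (nbhd C Y) x y.

(* For the vertex set of a Cayley graph, whose adjacent vertices are those at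
   distance 1, these are the edge paths. *)
Definition joined_by_path Y (x y : X) :=
  exists (n : nat) (p : nat -> X), [/\ p 0%N = x, p n = y,
    forall i, (i < n)%N -> mdist (p i) (p i.+1) = 1
  & forall i, (i <= n)%N -> Y (p i)].

Definition C_path_connected (C : R) Y := forall x y, Y x -> Y y ->
  joined_by_path (nbhd C Y) x y.

End Coarse.

Section Thickness.
Local Open Scope ring_scope.
Local Open Scope classical_set_scope.
Variable R : realType.

Definition wide (G : fg_group) :=
  (forall (D : cone_data (cayley R G)) (p : asymptotic_cone D), ~ cut_point p) /\
  (exists L M : R, 1 <= L /\ forall x : cayley R G,
     exists2 c : R -> cayley R G, quasi_geodesic L L setT c
                                & exists t, mdist x (c t) <= M).

Record tight_network (C : R) (G : fg_group) (HH : set (set G)) : Prop := {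
  network_subgroup : forall H, HH H -> is_subgroup H;
  network_quasi_convex : forall H, HH H -> quasi_convex C (H : set (cayley R G));
  network_generates : finite_index (generated (\bigcup_(H in HH) H));
  network_connected : forall H H', HH H -> HH H' ->
    exists (n : nat) (K : nat -> set G),
      [/\ K 0%N = H, K n = H', forall i, (i <= n)%N -> HH (K i)
      & forall i, (i < n)%N -> infinite_set (K i `&` K i.+1) /\
          C_path_connected C (K i `&` K i.+1 : set (cayley R G))]
}.

(* [H] is the image of [f], which identifies the abstract group [K] with it. *)
Definition embeds_onto (G K : groupType) (f : K -> G) (H : set G) :=
  [/\ {morph f : x y / (x * y)%g}, injective f & range f = H].

(* A subgroup is thick if it is thick as an abstract finitely generated group,
   for some choice of a finite generating set. *)
Fixpoint alg_thick (k : nat) (G : fg_group) : Prop :=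
  if k is j.+1 then
    exists (C : R) (HH : set (set G)),
      [/\ 0 < C, finite_set HH, tight_network C HH
      & forall H, HH H -> exists (K : fg_group) (f : K -> G),
          embeds_onto f H /\ alg_thick j K]
  else wide G.

End Thickness.

Section RACG.
Local Open Scope quotient_scope.
Variable G : sgraph.

(* The congruence on words generated by the defining relations; the generators
   being involutions, inverse letters are not needed. *)
Inductive racg_rel : seq G -> seq G -> Prop :=
| racg_refl w : racg_rel w w
| racg_symm u v : racg_rel u v -> racg_rel v u
| racg_trans u v w : racg_rel u v -> racg_rel v w -> racg_rel u w
| racg_cat u u' v v' : racg_rel u u' -> racg_rel v v' -> racg_rel (u ++ v) (u' ++ v')
| racg_square s : racg_rel [:: s; s] [::]
| racg_comm s t : adj s t -> racg_rel [:: s; t] [:: t; s].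

Definition racg_eq : rel (seq G) := fun u v => `[< racg_rel u v >].

Lemma racg_eq_equiv : equiv_class_of racg_eq.
Proof.
split=> [w|u v|v u w]; first exact/asboolP/racg_refl.
  by apply/asboolP/asboolP; apply: racg_symm.
by move=> /asboolP uv /asboolP vw; apply/asboolP/(racg_trans uv vw).
Qed.

Canonical racg_eq_equiv_rel := EquivRelPack racg_eq_equiv.

Definition racg_type := {eq_quot racg_eq}.

HB.instance Definition _ := Choice.on racg_type.
HB.instance Definition _ := EqQuotient.on racg_type.

Definition racg_word (w : seq G) : racg_type := \pi w.

Lemma racg_wordP u v : racg_word u = racg_word v <-> racg_rel u v.
Proof.
rewrite /racg_word; split=> [/eqP|uv]; first by rewrite piE => /asboolP.
by apply/eqP; rewrite piE; apply/asboolP.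
Qed.

Definition racg_mul (x y : racg_type) := racg_word (repr x ++ repr y).
Definition racg_inv (x : racg_type) := racg_word (rev (repr x)).

Lemma racg_wordK x : racg_word (repr x) = x.
Proof. exact: reprK. Qed.

Lemma racg_mulE u v : racg_mul (racg_word u) (racg_word v) = racg_word (u ++ v).
Proof. by apply/racg_wordP/racg_cat; apply/racg_wordP/racg_wordK. Qed.

Lemma racg_rel_rev u v : racg_rel u v -> racg_rel (rev u) (rev v).
Proof.
elim=> [w|? ? _|? ? ? _ uv _ vw|? ? ? ? _ uu _ vv|s|s t st].
- exact: racg_refl.
- exact: racg_symm.
- exact: racg_trans uv vw.
- by rewrite !rev_cat; apply: racg_cat.
- exact: racg_square.
- by apply: racg_comm; rewrite adj_sym.
Qed.

Lemma racg_invE u : racg_inv (racg_word u) = racg_word (rev u).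
Proof. by apply/racg_wordP/racg_rel_rev/racg_wordP/racg_wordK. Qed.

Lemma racg_revV u : racg_word (rev u ++ u) = racg_word [::].
Proof.
apply/racg_wordP; elim: u => [|s u IH]; first exact: racg_refl.
rewrite rev_cons -cats1 -catA /=; apply: racg_trans IH.
apply: racg_cat; first exact: racg_refl.
exact: (racg_cat (racg_square s) (racg_refl u)).
Qed.

Let mulA : associative racg_mul.
Proof.
move=> x y z; rewrite -[x]racg_wordK -[y]racg_wordK -[z]racg_wordK.
by rewrite !racg_mulE catA.
Qed.

Let mul1 : left_id (racg_word [::]) racg_mul.
Proof. by move=> x; rewrite -[x]racg_wordK racg_mulE. Qed.

Let mulx1 : right_id (racg_word [::]) racg_mul.
Proof. by move=> x; rewrite -[x]racg_wordK racg_mulE cats0. Qed.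

Let mulV : left_inverse (racg_word [::]) racg_inv racg_mul.
Proof. by move=> x; rewrite -[x]racg_wordK racg_invE racg_mulE racg_revV. Qed.

Let mulxV : right_inverse (racg_word [::]) racg_inv racg_mul.
Proof.
move=> x; rewrite -[x]racg_wordK racg_invE racg_mulE.
by rewrite -{1}[repr x]revK racg_revV.
Qed.

HB.instance Definition _ := isGroup.Build racg_type mulA mul1 mulx1 mulV mulxV.

Definition racg_gen (s : G) : racg_type := racg_word [:: s].

Lemma racg_gens_finite : finite_set (range racg_gen).
Proof. exact/finite_image/finite_finset. Qed.

Lemma racg_gens_generate : generated (range racg_gen) = setT.
Proof.
apply/seteqP; split=> // x _ H [[H1 HF] gH].
have HV y : H y -> H (y^-1)%g by move/(HF _ _ H1); rewrite mul1g.
rewrite -[x]racg_wordK; elim: (repr x) => [//|s w Hw].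
have -> : racg_word (s :: w) = (racg_gen s * (racg_word w)^-1^-1)%g.
  by rewrite invgK; apply/esym/racg_mulE.
by apply: HF; [apply: gH; exists s|apply: HV].
Qed.

Definition racg : fg_group := FgGroup racg_gens_finite racg_gens_generate.

End RACG.

(* Main.v *)
Require Import Defs.
From HB Require Import structures.
From mathcomp Require Import all_boot all_order all_algebra.

Set Implicit Arguments.
Unset Strict Implicit.
Unset Printing Implicit Defensive.

(** A strip subgroup is virtually cyclic, hence never thick; the proof consists in
    doing without strips.

    In each hypergraph a hyperedge either contains a wide subgraph or is a single
    suspended clique ([Lambda_invariant]). As a strip has only one non-adjacent
    pair, the hyperedges of a class that contain wide subgraphs are chained by
    common non-adjacent pairs among themselves, and each strip of the class is
    attached to one of them along its pair ([class_structure]).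

    At the first level strips bring no new vertices
    ([suspended_vertex_in_Omega]): the hyperedge is a union of wide subgraphs and
    its subgroup is a network of wide subgroups, thick of order at most 1. At a
    higher level, let [k] be a vertex of the clique of a strip attached to [B]
    along [s], [t]. The special subgroup of [B] and its conjugate by [k] generate
    a subgroup of index 2 in the special subgroup of [B] and [k], and they
    intersect in the special subgroup of the neighbours of [k] in [B], which
    contains the infinite dihedral group of [s] and [t] ([cone_thick]). So
    adjoining [k] to [B] raises the order by at most 1, and the subgroup of the
    new hyperedge is a network of the subgroups thus enlarged
    ([union_thick]). Each level after the first costs at most 2, whence
    [2 * h - 1].

    The geometry of the Coxeter group is obtained from retractions. Deleting the
    letters outside a set of generators is a 1-Lipschitz retraction onto a special
    subgroup, so that special subgroups are convex and intersect in special
    subgroups. The centralizer of a generator is found by a folding map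
    ([parabolic_centralizer]), and infinite dihedral subgroups are seen through
    their action on the integers.

    The special subgroup of a wide subgraph [A * B] is a product of two infinite
    groups. In its asymptotic cones a point other than [p] differs from [p] in
    one of the two coordinates, and can be moved in the other coordinate, and
    then in this one, to a fixed point with both coordinates different from those
    of [p], without meeting [p] ([detour]). Hence there are no cut-points
    ([no_cut_point]). *)

(** * Hyperedges containing wide subgraphs *)

Section Combinatorics.
Variable G : sgraph.
Implicit Types A B K L M H S : {set G}.
Implicit Types C E F : {set {set G}}.

Definition nonadj (s t : G) := (s != t) && ~~ adj s t.

Lemma nonadj_sym s t : nonadj s t = nonadj t s.
Proof. by rewrite /nonadj eq_sym adj_sym. Qed.

Lemma nonadjxx s : nonadj s s = false.
Proof. by rewrite /nonadj eqxx. Qed.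

Lemma has_nonadjP A :
  reflect (exists s t, [/\ s \in A, t \in A & nonadj s t]) (has_nonadj A).
Proof.
apply: (iffP exists_inP) => [[s sA /exists_inP[t tA st]]|[s [t [sA tA st]]]].
  by exists s, t.
by exists s => //; apply/exists_inP; exists t.
Qed.

Lemma has_nonadjS A B : A \subset B -> has_nonadj A -> has_nonadj B.
Proof.
move=> /subsetP sAB /has_nonadjP[s [t [sA tA st]]].
by apply/has_nonadjP; exists s, t; split; rewrite ?sAB.
Qed.

Lemma has_nonadj2 s t : nonadj s t -> has_nonadj [set s; t].
Proof. by move=> st; apply/has_nonadjP; exists s, t; rewrite !inE !eqxx orbT. Qed.

Lemma nonadj_joinP L :
  reflect (exists A B, [/\ L = A :|: B, {in A & B, forall s t, adj s t},
                           has_nonadj A & has_nonadj B]) (nonadj_join L).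
Proof.
apply: (iffP existsP) => [[A /existsP[B /and3P[/andP[/eqP LE AB] hA hB]]]|].
  exists A, B; split=> // s t sA tB.
  by move/forall_inP: AB => /(_ s sA) /forall_inP /(_ t tB).
move=> [A [B [LE AB hA hB]]]; exists A; apply/existsP; exists B.
rewrite hA hB !andbT /is_join LE eqxx /=.
by apply/forall_inP => s sA; apply/forall_inP => t tB; apply: AB.
Qed.

Lemma suspended_cliqueP L :
  reflect (exists s t K, [/\ L = [set s; t] :|: K, nonadj s t,
     {in K, forall k, adj s k /\ adj t k}, K != set0
     & {in K &, forall k l, ~~ nonadj k l}]) (suspended_clique L).
Proof.
apply: (iffP existsP) => [[s]|[s [t [K [LE st stK K0 Kc]]]]].
  move=> /existsP[t /existsP[K /and5P[nst ast K0 Kc /andP[/eqP LE]]]].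
  move/forall_inP=> stK; exists s, t, K; split=> //.
  - exact/andP.
  - move=> k kK; split.
      by have /forall_inP/(_ k kK) := stK s (set21 s t).
    by have /forall_inP/(_ k kK) := stK t (set22 s t).
  - move=> k l kK lK; move/forall_inP: Kc => /(_ k kK)/forall_inP/(_ l lK).
    by rewrite /nonadj negb_and implybE !negbK.
exists s; apply/existsP; exists t; apply/existsP; exists K.
case/andP: (st) => -> -> /=; rewrite K0 /is_join LE eqxx /=; apply/andP; split.
  apply/forall_inP => k kK; apply/forall_inP => l lK.
  by move: (Kc k l kK lK); rewrite /nonadj negb_and implybE !negbK.
apply/forall_inP => v; rewrite !inE => /orP[]/eqP->;
  by apply/forall_inP => k /stK[].
Qed.

(** The clique of a strip and its joining edges contain no non-adjacent pair, so
    only the two suspension vertices are left. This rigidity is what makes chains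
    of strips trivial. *)
Lemma suspended_nonadj L s t u v : suspended_clique L ->
  s \in L -> t \in L -> nonadj s t -> u \in L -> v \in L -> nonadj u v ->
  [set s; t] = [set u; v].
Proof.
move=> /suspended_cliqueP[a [b [K [-> ab abK _ Kc]]]].
suff aux x y : x \in [set a; b] :|: K -> y \in [set a; b] :|: K ->
    nonadj x y -> [set x; y] = [set a; b].
  by move=> sL tL st uL vL uv; rewrite (aux s t) // (aux u v).
have nK a1 a2 : adj a1 a2 -> nonadj a1 a2 -> False.
  by move=> a12 /andP[_]; rewrite a12.
rewrite !inE => /orP[/orP[]/eqP->|xK] /orP[/orP[]/eqP->|yK] xy //.
- by rewrite nonadjxx in xy.
- by case: (nK _ _ (abK _ yK).1 xy).
- by rewrite setUC.
- by rewrite nonadjxx in xy.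
- by case: (nK _ _ (abK _ yK).2 xy).
- by rewrite nonadj_sym in xy; case: (nK _ _ (abK _ xK).1 xy).
- by rewrite nonadj_sym in xy; case: (nK _ _ (abK _ xK).2 xy).
- by move: (Kc _ _ xK yK); rewrite xy.
Qed.

Lemma suspended_adj L s t k : suspended_clique L ->
  s \in L -> t \in L -> nonadj s t -> k \in L -> k \notin [set s; t] ->
  adj s k /\ adj t k.
Proof.
move=> Ls sL tL st kL kst.
have sk x : x \in [set s; t] -> adj x k.
  move=> xst; apply: contraT => nxk.
  have xL : x \in L by move: xst; rewrite !inE => /orP[]/eqP->.
  have xk : nonadj x k by rewrite /nonadj nxk andbT; apply: contraNneq kst => <-.
  by rewrite (suspended_nonadj Ls sL tL st xL kL xk) !inE eqxx orbT in kst.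
by split; apply: sk; rewrite !inE eqxx ?orbT.
Qed.

(** The two sides of a wide join give two disjoint non-adjacent pairs, and a
    strip has only one. *)
Lemma suspended_not_wide L M : suspended_clique L -> M \subset L -> ~~ nonadj_join M.
Proof.
move=> Ls /subsetP ML; apply/negP => /nonadj_joinP[A [B [ME AB]]].
move=> /has_nonadjP[s [t [sA tA st]]] /has_nonadjP[u [v [uB vB uv]]].
have /setP/(_ u) : [set s; t] = [set u; v].
  by apply: (suspended_nonadj Ls) => //; apply: ML; rewrite ME inE ?sA ?tA ?uB ?vB ?orbT.
rewrite !inE eqxx /= => /orP[]/eqP uE.
  by have := AB _ _ sA uB; rewrite uE adj_irr.
by have := AB _ _ tA uB; rewrite uE adj_irr.
Qed.

Lemma connect_meets E H H' : H \in E -> H' \in E -> has_nonadj (H :&: H') ->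
  connect (meets_nonadj E) H H'.
Proof. by move=> HE H'E h; apply/connect1/and3P. Qed.

(** In each hypergraph this property separates the hyperedges that carry a thick
    subgroup from the isolated strips. *)
Definition contains_wide H := [exists M in Omega G, M \subset H].

Lemma Omega_join M : M \in Omega G -> nonadj_join M.
Proof. by rewrite inE => /maxsetp. Qed.

Lemma Omega_sup L : nonadj_join L -> exists2 M, M \in Omega G & L \subset M.
Proof.
by move=> /(@maxset_exists _ (@nonadj_join G)) [M mM LM]; exists M; rewrite ?inE.
Qed.

Lemma square_join s t u v : nonadj s t -> nonadj u v ->
  adj s u -> adj s v -> adj t u -> adj t v -> nonadj_join ([set s; t] :|: [set u; v]).
Proof.
move=> st uv su sv tu tv; apply/nonadj_joinP; exists [set s; t], [set u; v].
split; try exact: has_nonadj2; first by [].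
by move=> x y; rewrite !inE => /orP[]/eqP-> /orP[]/eqP->.
Qed.

Lemma contains_wide_nonadj H : contains_wide H -> has_nonadj H.
Proof.
case/exists_inP => M /Omega_join/nonadj_joinP[A [B [-> _ hA _]]] MH.
exact: has_nonadjS (subset_trans (subsetUl _ _) MH) hA.
Qed.

Lemma suspended_not_contains_wide H : suspended_clique H -> ~~ contains_wide H.
Proof.
move=> Hs; apply/negP => /exists_inP[M /Omega_join MJ MH].
by have := suspended_not_wide Hs MH; rewrite MJ.
Qed.

Lemma contains_wideS H H' : H \subset H' -> contains_wide H -> contains_wide H'.
Proof.
move=> HH' /exists_inP[M MO MH]; apply/exists_inP; exists M => //.
exact: subset_trans HH'.
Qed.

(** Strips add no vertex to a union of wide subgraphs: if [k] is joined to a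
    non-adjacent pair of [M = A * B], then a vertex of [M] not adjacent to [k]
    spans with [k] one side of a wide join whose other side is a non-adjacent
    pair of [M]; if there is no such vertex, then [M] together with [k] is still
    a wide join, and [k] is in [M] by maximality. *)
Lemma suspended_vertex_in_Omega M s t k :
  M \in Omega G -> s \in M -> t \in M -> nonadj s t ->
  adj s k -> adj t k ->
  exists M', [/\ M' \in Omega G, k \in M' & has_nonadj (M :&: M')].
Proof.
move=> MO; move: (MO) => /Omega_join/nonadj_joinP[A [B [ME AB hA hB]]].
wlog [sA tA] : A B ME AB hA hB / s \in A /\ t \in A.
  move=> wl sM tM st sk tk.
  have /andP[_ ast] := st.
  have /setUP[sA|sB] : s \in A :|: B by rewrite -ME.
    have /setUP[tA|tB] : t \in A :|: B by rewrite -ME.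
      exact: (wl A B).
    by rewrite AB in ast.
  have /setUP[tA|tB] : t \in A :|: B by rewrite -ME.
    by rewrite adj_sym AB in ast.
  by apply: (wl B A) => //; [rewrite setUC|move=> x y xB yA; rewrite adj_sym AB].
move=> sM tM st sk tk.
have AM : A \subset M by rewrite ME subsetUl.
have BM : B \subset M by rewrite ME subsetUr.
have [kM|kM] := boolP (k \in M).
  by exists M; rewrite setIid (has_nonadjS AM).
case: (boolP [exists b in B, ~~ adj k b]) => [/exists_inP[b bB kb]|].
  have bk : nonadj b k.
    rewrite /nonadj adj_sym kb andbT; apply: contraNneq kM => <-.
    exact: (subsetP BM).
  have [M' M'O /subsetP sM'] := Omega_sup
    (square_join st bk (AB _ _ sA bB) sk (AB _ _ tA bB) tk).
  exists M'; split=> //; first by apply: sM'; rewrite !inE eqxx !orbT.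
  by apply/has_nonadjP; exists s, t; split=> //; rewrite inE ?sM ?tM;
    apply: sM'; rewrite !inE eqxx ?orbT.
rewrite negb_exists_in => /forall_inP kB.
case: (boolP [exists a in A, ~~ adj k a]) => [/exists_inP[a aA ka]|].
  have ak : nonadj a k.
    rewrite /nonadj adj_sym ka andbT; apply: contraNneq kM => <-.
    exact: (subsetP AM).
  have /has_nonadjP[b [c [bB cB bc]]] := hB.
  have kb : adj k b by have := kB _ bB; rewrite negbK.
  have kc : adj k c by have := kB _ cB; rewrite negbK.
  have [M' M'O /subsetP sM'] := Omega_sup
    (square_join ak bc (AB _ _ aA bB) (AB _ _ aA cB) kb kc).
  exists M'; split=> //; first by apply: sM'; rewrite !inE eqxx !orbT.
  by apply/has_nonadjP; exists b, c; split=> //; rewrite inE (subsetP BM) //=;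
    apply: sM'; rewrite !inE eqxx ?orbT.
rewrite negb_exists_in => /forall_inP kA.
have kJ : nonadj_join (k |: M).
  apply/nonadj_joinP; exists (k |: A), B; rewrite -setUA -ME; split=> //.
    by move=> x y /setU1P[->|xA] yB; [have := kB _ yB; rewrite negbK|apply: AB].
  exact: has_nonadjS (subsetUr _ _) hA.
move: MO; rewrite inE => /maxsetP[_ /(_ _ kJ (subsetUr _ _)) kME].
by rewrite -kME setU11 in kM.
Qed.

Section SmallClass.
Variable E : {set {set G}}.
Hypothesis small_suspended : forall H,
  H \in E -> ~~ contains_wide H -> suspended_clique H.
Hypothesis join_in_edge : forall L, nonadj_join L ->
  exists H, [/\ H \in E, contains_wide H & L \subset H].

(** A class without wide subgraphs is a class of strips chained by common
    non-adjacent pairs, hence suspensions of one pair [s], [t]. Two non-adjacent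
    vertices of its cliques would span with [s], [t] a wide join, and the
    hyperedge containing this join would belong to the class. *)
Lemma small_class_suspended H0 : H0 \in E ->
  (forall B, B \in Defs.equiv_class E H0 -> ~~ contains_wide B) ->
  suspended_clique (cover (Defs.equiv_class E H0)).
Proof.
move=> H0i; set C := Defs.equiv_class _ _ => nbC.
have H0C : H0 \in C by rewrite inE H0i connect0.
have susp B : B \in C -> suspended_clique B.
  move=> BC; apply: small_suspended; last exact: nbC.
  by move: BC; rewrite inE => /andP[].
have /suspended_cliqueP[s [t [K [H0E st stK K0 Kc]]]] := susp _ H0C.
have stH B : B \in C -> [set s; t] \subset B.
  rewrite inE => /andP[Bi /connectP[p]]; elim/last_ind: p B Bi => [|p D IH] B Bi.
    by move=> _ ->; rewrite H0E subsetUl.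
  rewrite rcons_path last_rcons => /andP[pth /and3P[Pi _ hPD]] BD.
  rewrite -{D}BD in hPD *.
  set P := last H0 p in Pi hPD.
  have PC : P \in C by rewrite inE Pi; apply/connectP; exists p.
  have stP := IH _ Pi pth erefl.
  have /has_nonadjP[u [v [/setIP[uP uB] /setIP[vP vB] uv]]] := hPD.
  rewrite (suspended_nonadj (susp _ PC) (s := s) (t := t) (u := u) (v := v)) //.
  - by apply/subsetP => x; rewrite !inE => /orP[]/eqP->.
  - by rewrite (subsetP stP) // !inE eqxx.
  - by rewrite (subsetP stP) // !inE eqxx orbT.
have stC : [set s; t] \subset cover C.
  by apply: subset_trans (stH _ H0C) _; apply: bigcup_sup H0C.
have adjC k : k \in cover C -> k \notin [set s; t] -> adj s k /\ adj t k.
  move=> /bigcupP[B BC kB].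
  by apply: (suspended_adj (susp _ BC)) => //; apply: (subsetP (stH _ BC));
    rewrite !inE eqxx ?orbT.
apply/suspended_cliqueP; exists s, t, (cover C :\: [set s; t]); split=> //.
- by rewrite -[LHS](setID _ [set s; t]) (setIidPr stC).
- by move=> k /setDP[kC kst]; apply: adjC.
- case/set0Pn: K0 => k kK; apply/set0Pn; exists k; rewrite inE; apply/andP; split.
    have [sk tk] := stK _ kK; rewrite !inE negb_or.
    by apply/andP; split; apply/eqP => kE; [move: sk|move: tk]; rewrite kE adj_irr.
  by apply/bigcupP; exists H0; rewrite // H0E inE kK orbT.
- move=> k l /setDP[kC kst] /setDP[lC lst]; apply/negP => kl.
  have [sk tk] := adjC k kC kst; have [sl tl] := adjC l lC lst.
  have [B [Bi bB /subsetP LB]] := join_in_edge (square_join st kl sk sl tk tl).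
  suff /nbC : B \in C by rewrite bB.
  rewrite inE Bi /=; apply: connect_meets => //.
  by apply/has_nonadjP; exists s, t; split=> //;
    rewrite H0E !inE eqxx ?orbT /= LB // !inE eqxx ?orbT.
Qed.

End SmallClass.

(** A simultaneous induction: the second property is what excludes, in the first,
    a wide join hidden in the union of a class of strips. *)
Lemma Lambda_invariant i :
  (forall H, H \in Lambda G i -> ~~ contains_wide H -> suspended_clique H) /\
  (forall L, nonadj_join L ->
     exists H, [/\ H \in Lambda G i, contains_wide H & L \subset H]).
Proof.
elim: i => [|i [IH1 IH2]]; split.
- move=> H /setUP[HO|]; last by rewrite inE => /and3P[].
  by case/exists_inP; exists H.
- move=> L /Omega_sup[M MO LM]; exists M; split=> //; first by rewrite inE MO.
  by apply/exists_inP; exists M.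
- move=> _ /imsetP[H0 H0i ->] nb.
  apply: small_class_suspended => // B BC; apply: contra nb; apply: contains_wideS.
  exact: bigcup_sup BC.
- move=> L /IH2[B [Bi bB LB]].
  have BC : B \subset cover (Defs.equiv_class (Lambda G i) B).
    by apply: bigcup_sup; rewrite inE Bi connect0.
  exists (cover (Defs.equiv_class (Lambda G i) B)); split.
  + exact: imset_f.
  + exact: contains_wideS bB.
  + exact: subset_trans BC.
Qed.

Definition chain_connected F :=
  {in F &, forall B B', connect (meets_nonadj F) B B'}.

Lemma meets_nonadj_sym E : symmetric (meets_nonadj E).
Proof.
by move=> H H'; apply/and3P/and3P => -[HE H'E h]; split=> //; rewrite setIC.
Qed.

Lemma meets_nonadjC E : connect_sym (meets_nonadj E).
Proof.
move=> x y; apply/connectP/connectP => -[p]; elim/last_ind: p x y => [|p z IH] x y.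
- by move=> _ ->; exists [::].
- rewrite rcons_path last_rcons => /andP[xp pz] ->.
  have [q yq xE] := IH _ _ xp erefl; exists (last x p :: q); rewrite //= yq andbT.
  by rewrite -/(meets_nonadj E _ _) meets_nonadj_sym.
- by move=> _ ->; exists [::].
- rewrite rcons_path last_rcons => /andP[xp pz] ->.
  have [q yq xE] := IH _ _ xp erefl; exists (last y p :: q); rewrite //= yq andbT.
  by rewrite -/(meets_nonadj E _ _) meets_nonadj_sym.
Qed.

Lemma connect_mono E F : E \subset F ->
  subrel (connect (meets_nonadj E)) (connect (meets_nonadj F)).
Proof.
move=> /subsetP EF; apply: connect_sub => H H' /and3P[HE H'E h].
by apply: connect_meets; rewrite ?EF.
Qed.

(** A chain that passes through strips can be shortcut: a strip has a single
    non-adjacent pair, so the hyperedges before and after it share this pair.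
    Hence the hyperedges containing wide subgraphs are chained among themselves,
    and each strip of the class is attached to one of them. *)
Lemma class_structure i H : H \in Lambda G i.+1 -> contains_wide H ->
  exists2 C : {set {set G}}, C \subset Lambda G i &
    [/\ H = cover C, [set B in C | contains_wide B] != set0,
    chain_connected [set B in C | contains_wide B],
    {in C, forall S, exists B, [/\ B \in C, contains_wide B & has_nonadj (S :&: B)]}
  & {in C & Lambda G i, forall B S, has_nonadj (B :&: S) -> S \in C} ].
Proof.
move=> Hi bH; case/imsetP: (Hi) => H0 H0i HE.
set C := Defs.equiv_class (Lambda G i) H0 in HE.
have [small_s join_in] := Lambda_invariant i.
have closedC : {in C & Lambda G i, forall B S, has_nonadj (B :&: S) -> S \in C}.
  move=> B S; rewrite inE => /andP[Bi H0B] Si h; rewrite inE Si.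
  by apply: connect_trans H0B _; apply: connect_meets.
have [B0 /setIdP[B0C B0b]] : exists B, B \in [set B in C | contains_wide B].
  apply/set0Pn; apply/negP => /eqP C0.
  have /suspended_not_contains_wide : suspended_clique H; last by rewrite bH.
  rewrite HE; apply: small_class_suspended => // B BC; apply/negP => bB.
  by move/setP: C0 => /(_ B); rewrite inE BC bB inE.
have reach B1 S : B1 \in C -> contains_wide B1 -> S \in C ->
    exists B, [/\ B \in C, contains_wide B,
    connect (meets_nonadj [set B in C | contains_wide B]) B1 B, has_nonadj (S :&: B)
    & contains_wide S -> S = B].
  move=> B1C B1b SC.
  have /connectP[p] : connect (meets_nonadj (Lambda G i)) B1 S.
    move: B1C SC; rewrite !inE meets_nonadjC => /andP[_ B1H] /andP[_].
    exact: connect_trans.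
  (* Along the path [B] follows the hyperedges containing wide subgraphs and waits
     while the path runs through strips, which all keep the pair shared with [B]. *)
  elim/last_ind: p S SC => [|p D IH] S SC.
    by move=> _ ->; exists B1; rewrite connect0 setIid contains_wide_nonadj.
  rewrite rcons_path last_rcons => /andP[pth /and3P[Pi _ hPS]] SD.
  rewrite -{D}SD in hPS; set P := last B1 p in Pi hPS.
  have PC : P \in C by apply: (closedC S); rewrite // setIC.
  have [B [BC bB B1B hPB PE]] := IH P PC pth erefl.
  have hBS : has_nonadj (S :&: B).
    have [/PE <-|nbP] := boolP (contains_wide P); first by rewrite setIC.
    have Ps := small_s _ Pi nbP.
    case/has_nonadjP: hPB => s [t [/setIP[sP sB] /setIP[tP tB] st]].
    case/has_nonadjP: hPS => u [v [/setIP[uP uS] /setIP[vP vS] uv]].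
    have stE := suspended_nonadj Ps uP vP uv sP tP st.
    have sub : [set s; t] \subset S :&: B.
      rewrite subsetI -{1}stE; apply/andP.
      by split; apply/subsetP => x; rewrite !inE => /orP[]/eqP->.
    exact: has_nonadjS sub (has_nonadj2 st).
  have [bS|nbS] := boolP (contains_wide S); last by exists B.
  exists S; split=> //; last by rewrite setIid contains_wide_nonadj.
  apply: connect_trans B1B _; rewrite setIC in hBS.
  by apply: connect_meets => //; rewrite inE ?SC ?BC.
exists C; first by apply/subsetP => B; rewrite inE => /andP[].
split=> //.
- by apply/set0Pn; exists B0; rewrite inE B0C.
- move=> B B' /setIdP[BC bB] /setIdP[B'C bB'].
  by have [D [_ _ BD _ /(_ bB') ->]] := reach B B' BC bB B'C.
- by move=> S /(reach B0 S B0C B0b)[B [BC bB _ h _]]; exists B.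
Qed.

(** The hypotheses on [P n A] are the properties of the statement that the
    subgroup generated by [A] is thick of order at most [n]. *)
Section Induction.
Variable P : nat -> {set G} -> Prop.
Hypothesis P_wide : forall M, nonadj_join M -> P 0 M.
Hypothesis P_union : forall n F, F != set0 -> {in F, forall B, P n B} ->
  chain_connected F -> P n.+1 (cover F).
Hypothesis P_cone : forall n B s t k, s \in B -> t \in B -> nonadj s t ->
  adj s k -> adj t k -> k \notin B -> P n B -> P n.+1 (k |: B).

Lemma P_mono n B : P n B -> P n.+1 B.
Proof.
move=> PB; rewrite (_ : B = cover [set B]); last by rewrite /cover big_set1.
apply: P_union => [|D /set1P->|D D' /set1P-> /set1P->] //.
by apply/set0Pn; exists B; rewrite inE.
Qed.

(** At the first level the strips are absorbed, so a single union suffices. *)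
Lemma P_Lambda1 H : H \in Lambda G 1 -> contains_wide H -> P 1 H.
Proof.
move=> Hi bH; have [C sC [-> nC cC touch closedC]] := class_structure Hi bH.
have bigO B : B \in C -> contains_wide B -> B \in Omega G.
  move=> /(subsetP sC); rewrite [Lambda G 0]/= inE => /orP[//|].
  by rewrite inE => /and3P[/suspended_not_contains_wide/negP].
have -> : cover C = cover [set B in C | contains_wide B].
  apply/eqP; rewrite eqEsubset; apply/andP; split; last first.
    by apply/bigcupsP => B /setIdP[BC _]; apply: bigcup_sup BC.
  apply/subsetP => k /bigcupP[S SC kS].
  have [bS|nbS] := boolP (contains_wide S).
    by apply/bigcupP; exists S; rewrite // inE SC.
  have Ss := (Lambda_invariant 0).1 _ (subsetP sC _ SC) nbS.
  have [M [MC bM hSM]] := touch _ SC.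
  have MO := bigO _ MC bM.
  case/has_nonadjP: hSM => s [t [/setIP[sS sM] /setIP[tS tM] st]].
  have [k_st|k_st] := boolP (k \in [set s; t]).
    apply/bigcupP; exists M; first by rewrite inE MC.
    by move: k_st; rewrite !inE => /orP[]/eqP->.
  have [sk tk] := suspended_adj Ss sS tS st kS k_st.
  have [M' [M'O kM' hMM']] := suspended_vertex_in_Omega MO sM tM st sk tk.
  apply/bigcupP; exists M' => //; rewrite inE; apply/andP; split.
    by apply: (closedC M) => //; apply/setUP; left.
  by apply/exists_inP; exists M'.
by apply: (P_union nC) cC => M /setIdP[MC bM]; apply/P_wide/Omega_join/bigO.
Qed.

(** Above the first level strips do add vertices. Each is first adjoined to a
    single hyperedge by a cone, and then the enlarged hyperedges are united: two
    orders for each level. *)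
Lemma P_Lambda i H : H \in Lambda G i.+1 -> contains_wide H -> P (2 * i).+1 H.
Proof.
elim: i H => [|i IH] H Hi bH; first exact: P_Lambda1.
have [C sC [HE nC cC touch _]] := class_structure Hi bH.
pose attached B k := (k \in B) ||
  [exists s in B, exists t in B, [&& nonadj s t, adj s k & adj t k]].
(* The hyperedges themselves are kept in the family, as links of its chains. *)
pose F := [set k |: B | B in [set B in C | contains_wide B],
                        k in [set k in H | attached B k]].
have nonempty B : contains_wide B -> exists k, k \in B.
  by move=> /contains_wide_nonadj/has_nonadjP[s [t [sB _ _]]]; exists s.
have BH B : B \in C -> B \subset H by move=> BC; rewrite HE; apply: bigcup_sup BC.
have inF B k : B \in C -> contains_wide B -> k \in H -> attached B k -> k |: B \in F.
  by move=> BC bB kH Bk; apply/imset2P; exists B k; rewrite ?inE ?BC ?bB ?kH.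
have BF : [set B in C | contains_wide B] \subset F.
  apply/subsetP => B /setIdP[BC bB]; have [k kB] := nonempty B bB.
  have <- : k |: B = B by apply/setUidPr; rewrite sub1set.
  by apply: inF; rewrite // ?(subsetP (BH _ BC)) // /attached kB.
have -> : H = cover F.
  apply/eqP; rewrite eqEsubset; apply/andP; split; apply/subsetP => k.
    move=> kH; have /bigcupP[S SC kS] : k \in cover C by rewrite -HE.
    have [bS|nbS] := boolP (contains_wide S).
      by apply/bigcupP; exists S => //; apply: (subsetP BF); rewrite inE SC.
    have Ss := (Lambda_invariant i.+1).1 _ (subsetP sC _ SC) nbS.
    have [B [BC bB hSB]] := touch _ SC.
    case/has_nonadjP: hSB => s [t [/setIP[sS sB] /setIP[tS tB] st]].
    apply/bigcupP; exists (k |: B); last exact: setU11.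
    apply: inF => //; apply/orP.
    have [|k_st] := boolP (k \in [set s; t]).
      by rewrite !inE => /orP[]/eqP->; left.
    right; apply/exists_inP; exists s => //; apply/exists_inP; exists t => //.
    by have [sk tk] := suspended_adj Ss sS tS st kS k_st; rewrite st sk tk.
  case/bigcupP=> _ /imset2P[B l /setIdP[BC _] /setIdP[lH _] ->].
  by case/setU1P => [->//|]; apply: (subsetP (BH _ BC)).
rewrite mulnS; apply: (P_union (n := (2 * i).+2)).
- case/set0Pn: nC => B /(subsetP BF) BF'; apply/set0Pn; by exists B.
- move=> _ /imset2P[B k /setIdP[BC bB] /setIdP[kH Bk] ->].
  have PB : P (2 * i).+1 B by apply: IH => //; apply: (subsetP sC).
  have [kB|kB] := boolP (k \in B).
    by rewrite (setUidPr _) ?sub1set //; apply: P_mono.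
  move: Bk; rewrite /attached (negbTE kB) /= => ex.
  case/exists_inP: ex => s sB /exists_inP[t tB /and3P[st sk tk]].
  exact: (P_cone sB tB).
- have toF B k : B \in C -> contains_wide B -> k \in H -> attached B k ->
      connect (meets_nonadj F) (k |: B) B.
    move=> BC bB kH Bk; apply: connect_meets; rewrite ?inF //.
      by rewrite (subsetP BF) // inE BC.
    by rewrite (setIidPr (subsetUr _ _)) contains_wide_nonadj.
  move=> _ _ /imset2P[B k BC /setIdP[kH kB] ->] /imset2P[B' k' B'C /setIdP[k'H k'B'] ->].
  have /setIdP[? ?] := BC; have /setIdP[? ?] := B'C.
  apply: connect_trans (toF _ _ _ _ kH kB) _ => //.
  apply: connect_trans (connect_mono BF (cC _ _ BC B'C)) _.
  by rewrite meets_nonadjC; apply: toF.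
Qed.

(** Any wide subgraph is contained in the full hyperedge. *)
Lemma hypergraph_index_induction h : 0 < h -> has_hypergraph_index G h ->
  P (2 * h - 1) setT.
Proof.
case: h => // i _ /and3P[/set0Pn[M MO] /exists_inP[H Hi /eqP HT] _].
rewrite mulnS add2n subn1 /= -HT.
by apply: P_Lambda => //; apply/exists_inP; exists M; rewrite // HT subsetT.
Qed.

End Induction.

End Combinatorics.

(* The classical sets are imported only now: they shadow the names and notations
   of the finite sets used above. *)
From mathcomp Require Import all_classical all_reals all_analysis.
From mathcomp Require Import zify ring lra.

Import Order.TTheory GRing.Theory Num.Theory.
Import numFieldNormedType.Exports.

(** * Special subgroups of right-angled Coxeter groups *)

Section GroupHoms.
Local Open Scope group_scope.
Variables (G K : groupType) (f : G -> K).
Hypothesis fM : {morph f : x y / x * y}.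

Lemma homg1 : f 1 = 1.
Proof. by apply: (mulgI (f 1)); rewrite -fM !mulg1. Qed.

Lemma homgV x : f x^-1 = (f x)^-1.
Proof. by apply: (mulgI (f x)); rewrite -fM !mulgV homg1. Qed.

Lemma homgX x n : f (x ^+ n) = f x ^+ n.
Proof. by elim: n => [|n IH]; rewrite ?expg0 ?homg1 // !expgS fM IH. Qed.

End GroupHoms.

Section RACG.
Local Open Scope group_scope.
Implicit Types G K L : sgraph.

Lemma racg_wordM G (u v : seq G) :
  racg_word (u ++ v) = (racg_word u : racg G) * racg_word v.
Proof. by apply/esym/racg_mulE. Qed.

Lemma racg_word0 G : racg_word [::] = 1 :> racg G.
Proof. by []. Qed.

Lemma racg_wordV G (u : seq G) : racg_word (rev u) = (racg_word u : racg G)^-1.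
Proof. by apply/esym/racg_invE. Qed.

Lemma racg_wordS G (a : G) (u : seq G) :
  racg_word (a :: u) = (racg_gen a : racg G) * racg_word u.
Proof. exact: (racg_wordM [:: a] u). Qed.

Lemma racg_word_surj G (x : racg G) : exists w : seq G, x = racg_word w.
Proof. by exists (repr x); rewrite racg_wordK. Qed.

Lemma racg_genV G (s : G) : (racg_gen s : racg G)^-1 = racg_gen s.
Proof. by rewrite -racg_wordV. Qed.

Lemma racg_genK G (s : G) : racg_gen s * racg_gen s = 1 :> racg G.
Proof. by rewrite -{1}racg_genV mulVg. Qed.

Lemma racg_word_prod G (w : seq G) :
  racg_word w = \prod_(s <- w) (racg_gen s : racg G).
Proof.
elim: w => [|s w IH]; first by rewrite big_nil.
by rewrite big_cons -IH -racg_wordM.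
Qed.

Lemma racg_length_le G (w : seq G) : word_length (racg_word w : racg G) <= size w.
Proof.
apply: word_length_min; exists [seq racg_gen s | s <- w].
rewrite size_map big_map racg_word_prod; split=> // x /mapP[s _ ->].
by left; exists s.
Qed.

Lemma racg_geodesic G (x : racg G) :
  exists w : seq G, racg_word w = x /\ size w = word_length x.
Proof.
have [v [<- vS ->]] := word_lengthP x.
elim: v vS => [|a v IH] vS; first by exists [::]; rewrite big_nil.
have [|w [wE sw]] := IH; first by move=> b bv; apply: vS; rewrite inE bv orbT.
have [s as_] : exists s, a = racg_gen s.
  have [[s _ <-]|[s _ sa]] := vS a (mem_head _ _); first by exists s.
  by exists s; rewrite -[a]invgK -sa racg_genV.
by exists (s :: w); rewrite big_cons -wE as_ -racg_wordM /= sw.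
Qed.

Lemma word_dist_left (G : fg_group) (z x y : G) :
  word_dist (z * x) (z * y) = word_dist x y.
Proof. by rewrite /word_dist invgM mulgA -(mulgA x^-1) mulVg mulg1. Qed.

Lemma word_length_dist (G : fg_group) (x : G) : word_length x = word_dist 1 x.
Proof. by rewrite /word_dist invg1 mul1g. Qed.

Lemma word_length1 (G : fg_group) : word_length (1 : G) = 0.
Proof. by rewrite word_length_dist word_distxx. Qed.

Lemma word_lengthM (G : fg_group) (x y : G) :
  word_length (x * y) <= word_length x + word_length y.
Proof.
rewrite !word_length_dist; apply: leq_trans (word_dist_triangle x _ _) _.
by rewrite leq_add2l -{1}[x]mulg1 word_dist_left.
Qed.

Lemma word_lengthV (G : fg_group) (x : G) : word_length x^-1 = word_length x.
Proof.
rewrite word_length_dist -(word_dist_left x) mulgV mulg1 word_dist_sym.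
by rewrite -word_length_dist.
Qed.

Lemma racg_length_gen G (s : G) : word_length (racg_gen s : racg G) <= 1.
Proof. exact: (racg_length_le [:: s]). Qed.

(** Letters may be deleted or renamed; adjacency of the surviving letters is all
    that the defining relations ask for. Inclusions of special subgroups,
    retractions onto them and inverses of embeddings are all of this form. *)
Definition letter_map G K (phi : G -> option K) :=
  forall s t a b, adj s t -> phi s = Some a -> phi t = Some b -> adj a b.

Definition racg_hom G K (phi : G -> option K) (x : racg G) : racg K :=
  racg_word (pmap phi (repr x)).

Section Hom.
Variables (G K : sgraph) (phi : G -> option K).
Hypothesis phi_adj : letter_map phi.

Lemma racg_rel_pmap (u v : seq G) : racg_rel u v -> racg_rel (pmap phi u) (pmap phi v).
Proof.
elim=> [w|? ? _|? ? ? _ uv _ vw|? ? ? ? _ uu _ vv|s|s t st].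
- exact: racg_refl.
- exact: racg_symm.
- exact: racg_trans uv vw.
- by rewrite !pmap_cat; apply: racg_cat.
- by rewrite /=; case: (phi s) => [a|]; [apply: racg_square|apply: racg_refl].
- rewrite /=; case sE: (phi s) => [a|]; case tE: (phi t) => [b|] /=;
    try exact: racg_refl.
  exact/racg_comm/(phi_adj st).
Qed.

Lemma racg_homE (w : seq G) : racg_hom phi (racg_word w) = racg_word (pmap phi w).
Proof. by apply/racg_wordP/racg_rel_pmap/racg_wordP; rewrite racg_wordK. Qed.

Lemma racg_homM : {morph racg_hom phi : x y / x * y}.
Proof.
move=> x y; have [u ->] := racg_word_surj x; have [v ->] := racg_word_surj y.
by rewrite -racg_wordM !racg_homE pmap_cat racg_wordM.
Qed.

Lemma racg_hom_length (x : racg G) : word_length (racg_hom phi x) <= word_length x.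
Proof.
have [w [<- <-]] := racg_geodesic x; rewrite racg_homE.
by apply: leq_trans (racg_length_le _) _; rewrite size_pmap count_size.
Qed.

End Hom.

Lemma racg_hom_comp G K L (phi : G -> option K) (psi : K -> option L) (x : racg G) :
  letter_map phi -> letter_map psi ->
  racg_hom psi (racg_hom phi x) = racg_hom (fun s => obind psi (phi s)) x.
Proof.
move=> phi_adj psi_adj; have [w ->] := racg_word_surj x.
rewrite !racg_homE //; last first.
  move=> s t a b st /=; case sE: (phi s) => [c|//]; case tE: (phi t) => [d|//] /=.
  by apply: psi_adj; apply: phi_adj st sE tE.
congr racg_word; elim: w => //= s w IH.
by case: (phi s) => [c|] //=; case: (psi c) => //= a; rewrite IH.
Qed.

Lemma eq_racg_hom G K (phi psi : G -> option K) :
  phi =1 psi -> racg_hom phi =1 racg_hom psi.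
Proof. by move=> e x; rewrite /racg_hom (eq_pmap e). Qed.

Lemma racg_hom_id G (x : racg G) : racg_hom Some x = x.
Proof.
rewrite /racg_hom -[RHS]racg_wordK; congr racg_word.
by elim: (repr x) => //= s w ->.
Qed.

Definition delete_outside G (S : {set G}) (s : G) := if s \in S then Some s else None.

Lemma delete_adj G (S : {set G}) : letter_map (delete_outside S).
Proof.
move=> s t a b st; rewrite /delete_outside.
by case: ifP => // _ [<-]; case: ifP => // _ [<-].
Qed.

Definition retract G (S : {set G}) := racg_hom (delete_outside S).

Lemma pmap_delete G (S : {set G}) (w : seq G) :
  pmap (delete_outside S) w = [seq s <- w | s \in S].
Proof.
by elim: w => //= s w ->; rewrite /delete_outside; case: ifP.
Qed.

Lemma retractE G (S : {set G}) (w : seq G) :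
  retract S (racg_word w) = racg_word [seq s <- w | s \in S].
Proof. by rewrite /retract racg_homE ?pmap_delete //; apply: delete_adj. Qed.

Lemma retractM G (S : {set G}) : {morph retract S : x y / x * y}.
Proof. exact/racg_homM/delete_adj. Qed.

Lemma retractV G (S : {set G}) x : retract S x^-1 = (retract S x)^-1.
Proof. exact/homgV/retractM. Qed.

Lemma retract_length G (S : {set G}) x : word_length (retract S x) <= word_length x.
Proof. exact/racg_hom_length/delete_adj. Qed.

Lemma retractI G (S T : {set G}) x : retract S (retract T x) = retract (T :&: S) x.
Proof.
have [w ->] := racg_word_surj x; rewrite !retractE -filter_predI.
by congr racg_word; apply: eq_filter => s; rewrite /= inE andbC.
Qed.

Lemma retract_gen G (S : {set G}) s :
  retract S (racg_gen s) = if s \in S then racg_gen s else 1.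
Proof. by rewrite /racg_gen retractE /=; case: ifP. Qed.

Lemma retract_disjoint G (S T : {set G}) x :
  [disjoint S & T] -> retract S (retract T x) = 1.
Proof.
have [w ->] := racg_word_surj x; rewrite !retractE -filter_predI => /pred0P ST.
by rewrite (eq_filter (a2 := pred0)) ?filter_pred0.
Qed.

Definition parabolic G (S : {set G}) : set (racg G) := [set x | retract S x = x]%classic.

(** Deleting the letters outside [S] fixes the element and does not lengthen a
    word, so a geodesic word can be taken in [S]: special subgroups are convex. *)
Lemma parabolic_word G (S : {set G}) (x : racg G) : parabolic S x ->
  exists w : seq G, [/\ racg_word w = x, all (mem S) w & size w = word_length x].
Proof.
move=> xS; have [w [wx sw]] := racg_geodesic x.
have fx : racg_word [seq s <- w | s \in S] = x by rewrite -retractE wx.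
exists [seq s <- w | s \in S]; split=> //; first exact: filter_all.
apply/eqP; rewrite eqn_leq -{1}sw size_filter count_size /=.
by rewrite -{1}fx -size_filter racg_length_le.
Qed.

Lemma word_parabolic G (S : {set G}) (w : seq G) :
  all (mem S) w -> parabolic S (racg_word w).
Proof. by move=> /all_filterP wS; rewrite /parabolic /= retractE wS. Qed.

Lemma parabolicI G (S T : {set G}) :
  (parabolic S `&` parabolic T)%classic = parabolic (S :&: T).
Proof.
apply/seteqP; split=> x; rewrite /parabolic /=.
  by case=> xS xT; rewrite -retractI xS.
by move=> xST; split; rewrite -xST retractI (finset.setIidPl _)
  ?finset.subsetIl ?finset.subsetIr.
Qed.

Lemma parabolic_subgroup G (S : {set G}) : is_subgroup (parabolic S).
Proof.
split; first exact/homg1/retractM.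
by move=> x y; rewrite /parabolic /= => xS yS; rewrite retractM retractV xS yS.
Qed.

Lemma parabolic_comm G (S T : {set G}) (x y : racg G) :
  {in S & T, forall s t, adj s t} -> parabolic S x -> parabolic T y -> x * y = y * x.
Proof.
move=> ST /parabolic_word[u [<- uS _]] /parabolic_word[v [<- vT _]].
rewrite -!racg_wordM; apply/racg_wordP.
elim: u uS => [|s u IH] /= uS; first by rewrite cats0; apply: racg_refl.
case/andP: uS => sS uS.
apply: (racg_trans (v := s :: v ++ u)).
  by apply: (racg_cat (racg_refl [:: s])); apply: IH.
rewrite -cat_cons -cat_rcons; apply: racg_cat (racg_refl u).
elim: v vT {IH} => [|t v IH] /= vT; first exact: racg_refl.
case/andP: vT => tT vT.
apply: (racg_trans (v := t :: s :: v)).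
  by apply: (racg_cat (racg_comm (ST _ _ sS tT)) (racg_refl v)).
by apply: (racg_cat (racg_refl [:: t])); apply: IH.
Qed.

Lemma geodesic_take G (w : seq G) i j :
  word_length (racg_word w : racg G) = size w -> i <= j <= size w ->
  word_dist (racg_word (take i w) : racg G) (racg_word (take j w) : racg G) = j - i.
Proof.
move=> wg /andP[ij jw].
have le (a b : nat) : a <= b -> b <= size w ->
    word_dist (racg_word (take a w) : racg G) (racg_word (take b w)) <= b - a.
  move=> ab bw; rewrite /word_dist -{1}(subnKC ab) takeD racg_wordM mulKg.
  by apply: leq_trans (racg_length_le _) _; rewrite size_take_min geq_minl.
apply/eqP; rewrite eqn_leq le //=.
have := word_dist_triangle (racg_word (take i w) : racg G) 1 (racg_word w : racg G).
have := word_dist_triangle (racg_word (take j w) : racg G)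
  (racg_word (take i w) : racg G) (racg_word w : racg G).
rewrite -(word_length_dist (racg_word w : racg G)) wg.
have := le _ _ (leq0n i) (leq_trans ij jw); rewrite take0 racg_word0.
have := le _ _ jw (leqnn _); rewrite take_size; lia.
Qed.

(** For non-adjacent [s] and [t] the group acts on the integers, [s] and [t] by
    the reflections in 0 and 1/2 and the other generators trivially; no relation
    is violated because [s] and [t] do not commute. As a letter moves an integer
    by at most one step away from 0, this action bounds word length from below. *)
Section Dihedral.
Variables (G : sgraph) (s t : G).
Hypothesis st : nonadj s t.

Definition reflect_letter (a : G) (n : int) : int :=
  if a == s then (- n)%R else if a == t then (1 - n)%R else n.

Definition line_act (w : seq G) (n : int) : int := foldr reflect_letter n w.

Lemma line_act_rel u v : racg_rel u v -> line_act u =1 line_act v.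
Proof.
elim=> [w|? ? _ IH|? ? ? _ uv _ vw|? ? ? ? _ uu _ vv|a|a b ab] n //.
- by rewrite uv vw.
- by rewrite /line_act !foldr_cat -!/(line_act _ _) vv uu.
- by rewrite /= /reflect_letter; case: eqP => _; [|case: eqP => _] => //; lia.
- case/andP: st => nst ast; rewrite /= /reflect_letter.
  case: (eqVneq a s) => [as_|as_]; case: (eqVneq b s) => [bs|bs] //;
   case: (eqVneq a t) => [at_|at_]; case: (eqVneq b t) => [bt|bt] //;
   move: ab nst ast; rewrite ?as_ ?bs ?at_ ?bt ?adj_irr ?eqxx // => ab nst;
   by [rewrite ab|rewrite adj_sym ab].
Qed.

Lemma line_act_word (w : seq G) n : (`|line_act w n| <= `|n| + size w)%N.
Proof.
elim: w => [|a w IH] /=; first by rewrite addn0.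
by rewrite {1}/reflect_letter; case: eqP => _; [|case: eqP => _]; lia.
Qed.

Definition line_move (x : racg G) : int := line_act (repr x) 0.

Lemma line_moveE (w : seq G) : line_move (racg_word w) = line_act w 0.
Proof. by apply: line_act_rel; apply/racg_wordP; rewrite racg_wordK. Qed.

Lemma line_move_length (x : racg G) : (`|line_move x| <= word_length x)%N.
Proof.
have [w [<- <-]] := racg_geodesic x; rewrite line_moveE.
by have := line_act_word w 0.
Qed.

Definition zigzag : racg G := racg_gen s * racg_gen t.

Lemma line_move_zigzagM (x : racg G) : line_move (zigzag * x) = (line_move x - 1)%R.
Proof.
have [w ->] := racg_word_surj x; have -> : zigzag * racg_word w = racg_word [:: s, t & w].
  by rewrite !racg_wordS mulgA.
rewrite !line_moveE /line_act /= /reflect_letter !eqxx; case/andP: st => /negbTE nst _.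
rewrite eq_sym nst; lia.
Qed.

Lemma line_move_zigzagX n : line_move (zigzag ^+ n) = (- n%:Z)%R.
Proof.
elim: n => [|n IH]; first by rewrite expg0 -racg_word0 line_moveE.
rewrite expgS line_move_zigzagM IH; lia.
Qed.

Lemma zigzag_length n : n <= word_length (zigzag ^+ n) <= (2 * n)%N.
Proof.
apply/andP; split.
  by have := line_move_length (zigzag ^+ n); rewrite line_move_zigzagX; lia.
elim: n => [|n IH]; first by rewrite expg0 word_length1.
rewrite expgS; apply: leq_trans (word_lengthM _ _) _.
have zz : (word_length zigzag <= 2)%N.
  apply: leq_trans (word_lengthM _ _) _.
  by have := racg_length_gen s; have := racg_length_gen t; lia.
by rewrite mulnS leq_add.
Qed.

Lemma parabolic_zigzag (S : {set G}) n : s \in S -> t \in S -> parabolic S (zigzag ^+ n).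
Proof.
move=> sS tS; rewrite /parabolic /= (homgX (retractM S)) retractM.
by rewrite !retract_gen sS tS.
Qed.

Lemma parabolic_infinite (S : {set G}) : s \in S -> t \in S -> infinite_set (parabolic S).
Proof.
move=> sS tS; apply: (@sub_infinite_set _ (range (fun n => zigzag ^+ n))).
  by move=> _ [n _ <-]; apply: parabolic_zigzag.
suff inj : injective (fun n => zigzag ^+ n).
  by rewrite (eq_finite_set (inj_card_eq (in2W inj))); apply: infinite_nat.
by move=> m n /(congr1 line_move); rewrite !line_move_zigzagX; lia.
Qed.

End Dihedral.

(** The centralizer of [k] in a special subgroup avoiding [k], without any normal
    form for words. Let [k] exchange two copies of the remaining generators, glued
    along the neighbours of [k], and send the second copy back to the first by
    killing its other generators. On words this is [fold_double], the flag telling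
    in which copy the letter is read. *)
Section Centralizer.
Variables (G : sgraph) (k : G).

Fixpoint fold_double (p : bool) (w : seq G) : seq G :=
  if w is a :: w' then
    if a == k then fold_double (~~ p) w'
    else if p && ~~ adj k a then fold_double p w' else a :: fold_double p w'
  else [::].

Lemma fold_double_cat p u v :
  fold_double p (u ++ v) = fold_double p u ++ fold_double (p (+) odd (count_mem k u)) v.
Proof.
elim: u p => [|a u IH] p /=; first by rewrite addbF.
rewrite !IH; case: (a == k) => /=; rewrite add0n; first by rewrite addNb addbN.
by case: ifP.
Qed.

Lemma fold_double_rel u v : racg_rel u v ->
  odd (count_mem k u) = odd (count_mem k v) /\
  forall p, racg_rel (fold_double p u) (fold_double p v).
Proof.
elim=> [w|? ? _ [e IH]|? ? ? _ [uv IHu] _ [vw IHv]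
       |? ? ? ? _ [uu IHu] _ [vv IHv]|a|a b ab].
- by split=> // p; apply: racg_refl.
- by split=> // p; apply: racg_symm.
- by split=> [|p]; [rewrite uv vw|apply: racg_trans (IHu p) (IHv p)].
- split=> [|p]; first by rewrite !count_cat !oddD uu vv.
  by rewrite !fold_double_cat uu; apply: racg_cat.
- split=> [|p] /=; first by case: (a == k).
  case: eqP => // _; first exact: racg_refl.
  by case: (_ && _); [apply: racg_refl|apply: racg_square].
- split=> [|p] /=; first by rewrite addnCA.
  case: (eqVneq a k) => [ak|_]; case: (eqVneq b k) => [bk|_].
  + exact: racg_refl.
  + have -> : adj k b by rewrite -ak.
    rewrite !andbF; exact: racg_refl.
  + have -> : adj k a by rewrite -bk adj_sym.
    rewrite !andbF; exact: racg_refl.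
  + case: (p && ~~ adj k a); case: (p && ~~ adj k b); try exact: racg_refl.
    exact: racg_comm.
Qed.

(** [fold_double] reads [k w] in the second copy, which leaves the letters of [w]
    adjacent to [k], and [w k] in the first, which leaves [w]. *)
Lemma parabolic_centralizer (S : {set G}) (x : racg G) : k \notin S -> parabolic S x ->
  racg_gen k * x = x * racg_gen k -> parabolic [set s in S | adj k s] x.
Proof.
move=> kS /parabolic_word[w [<- wS _]]; rewrite -racg_wordS.
rewrite -[racg_gen k]/(racg_word [:: k]) -(racg_wordM w [:: k]) => /racg_wordP.
have kw : all (fun a => a != k) w.
  by apply: sub_all wS => a aS; apply: contraNneq kS => <-.
move=> /fold_double_rel[_ /(_ false)].
rewrite fold_double_cat /= eqxx.
have -> : fold_double true w = [seq s <- w | adj k s].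
  by elim: w kw {wS} => //= a w IH /andP[/negbTE-> /IH->]; case: (adj k a).
have -> : fold_double false w = w.
  by elim: w kw {wS} => //= a w IH /andP[/negbTE-> /IH->].
rewrite cats0 => /racg_wordP <-; apply: word_parabolic.
rewrite all_filter; apply: sub_all wS => a aS; apply/implyP => ka.
by rewrite /= inE ka andbT.
Qed.

End Centralizer.

Definition sgraph_embedding K G (e : K -> G) :=
  injective e /\ forall a b, adj (e a) (e b) = adj a b.

Section Embedding.
Variables (K G : sgraph) (e : K -> G).
Hypothesis eE : sgraph_embedding e.

Definition include : racg K -> racg G := racg_hom (Some \o e).
Definition restrict : racg G -> racg K := racg_hom (fun g => [pick a | e a == g]).

Lemma include_adj : letter_map (Some \o e).
Proof. by move=> s t a b st [<-] [<-]; rewrite eE.2. Qed.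

Lemma restrict_adj : letter_map (fun g => [pick a | e a == g]).
Proof.
move=> s t a b st; case: pickP => // c /eqP cs [<-]; case: pickP => // d /eqP dt [<-].
by rewrite -eE.2 cs dt.
Qed.

Lemma includeM : {morph include : x y / x * y}.
Proof. exact/racg_homM/include_adj. Qed.

Lemma includeK : cancel include restrict.
Proof.
move=> x; rewrite /restrict racg_hom_comp; [|exact: include_adj|exact: restrict_adj].
rewrite -[RHS]racg_hom_id; apply: eq_racg_hom => a /=.
case: pickP => [b /eqP/eE.1->//|/(_ a)]; by rewrite eqxx.
Qed.

Lemma range_include : range include = parabolic [set e a | a in K].
Proof.
have incl x : include (restrict x) = retract [set e a | a in K] x.
  rewrite /include racg_hom_comp; [|exact: restrict_adj|exact: include_adj].
  apply: eq_racg_hom => g /=; rewrite /delete_outside; case: pickP => [a /eqP <-|ng] /=.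
    by rewrite imset_f.
  by case: ifP => // /imsetP[a _ ga]; have := ng a; rewrite ga eqxx.
apply/seteqP; split=> [_ [x _ <-]|x xS]; first by rewrite /parabolic /= -incl includeK.
by exists (restrict x); rewrite // incl.
Qed.

End Embedding.

End RACG.

(** * Asymptotic cones *)

#[local] Existing Instance cone_ultra.

Section Cone.
Local Open Scope ring_scope.
Local Open Scope classical_set_scope.
Local Open Scope quotient_scope.
Variables (R : realType) (X : metricType R) (D : cone_data X).
Local Notation omega := (cone_filter D).
Local Notation s := (cone_scale D).

Definition cone_class (x : cone_seq D) : asymptotic_cone D :=
  \pi_({eq_quot (@cone_eq R X D)}) x.

Lemma cone_class_surj (p : asymptotic_cone D) : exists x, p = cone_class x.
Proof. by exists (repr p); rewrite /cone_class reprK. Qed.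

Lemma mdist_cone_class x y : mdist (cone_class x) (cone_class y) = cone_dist x y.
Proof.
have rep z : cone_dist (repr (cone_class z)) z = 0.
  apply/eqP; rewrite -/(cone_eq _ _).
  have : cone_class (repr (cone_class z)) == cone_class z by rewrite /cone_class reprK.
  by rewrite /cone_class piE.
change (cone_dist (repr (cone_class x)) (repr (cone_class y)) = cone_dist x y).
apply/eqP; rewrite eq_le; apply/andP; split.
  apply: le_trans (cone_dist_triangle x _ _) _; rewrite rep add0r.
  by apply: le_trans (cone_dist_triangle y _ _) _; rewrite (cone_dist_sym y) rep addr0.
apply: le_trans (cone_dist_triangle (repr (cone_class x)) _ _) _.
rewrite cone_dist_sym rep add0r.
by apply: le_trans (cone_dist_triangle (repr (cone_class y)) _ _) _; rewrite rep addr0.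
Qed.

Lemma cone_dist_le (x y : cone_seq D) c :
  (\forall n \near omega, rescaled D (val x) (val y) n <= c) -> cone_dist x y <= c.
Proof. exact/limr_le/cone_cvg. Qed.

Lemma cone_dist_ge (x y : cone_seq D) c :
  (\forall n \near omega, c <= rescaled D (val x) (val y) n) -> c <= cone_dist x y.
Proof. exact/limr_ge/cone_cvg. Qed.

Lemma rescaled_near_gt (x y : cone_seq D) c : c < cone_dist x y ->
  \forall n \near omega, c < rescaled D (val x) (val y) n.
Proof. exact/cvgr_gt/cone_cvg. Qed.

Lemma rescaled_near_le (x y : cone_seq D) :
  exists M, \forall n \near omega, rescaled D (val x) (val y) n <= M.
Proof.
exists (cone_dist x y + 1); near=> n; apply: ltW; near: n.
by apply: cvgr_lt; [exact: cone_cvg|rewrite ltrDl].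
Unshelve. all: by end_near. Qed.

Lemma rescaled_sym x y : rescaled D x y = rescaled D y x.
Proof. by apply/funext => n; rewrite /rescaled metric_sym. Qed.

Lemma rescaled_triangle y x z n :
  rescaled D x z n <= rescaled D x y n + rescaled D y z n.
Proof.
rewrite /rescaled -mulrDl ler_pM2r ?invr_gt0 ?cone_scale_gt0 //.
exact: metric_triangle.
Qed.

Lemma cone_seq_near (x : cone_seq D) (y : nat -> X) M :
  (\forall n \near omega, rescaled D (val x) y n <= M) ->
  `[< exists M, \forall n \near omega, rescaled D y (cone_base D) n <= M >].
Proof.
move=> xy; have /asboolP[N xN] := valP x; apply/asboolP; exists (M + N); near=> n.
apply: le_trans (rescaled_triangle (val x) _ _ _) _.
by apply: lerD; [rewrite rescaled_sym; near: n|near: n].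
Unshelve. all: by end_near. Qed.

Lemma scale_near_ge M : \forall n \near omega, M <= s n.
Proof. exact/cvgry_ge/cone_scale_cvg. Qed.

Lemma lipschitz_continuous (Y : metricType R) (f : R -> Y) M :
  (forall a b, mdist (f a) (f b) <= M * `|a - b|) -> continuous f.
Proof.
move=> fM a; apply/cvg_ballP => e e0; near=> b.
rewrite ballEmdist /=; apply: le_lt_trans (fM _ _) _.
have M1 : 0 < `|M| + 1 by rewrite ltr_wpDl.
apply: le_lt_trans (_ : (`|M| + 1) * `|a - b| < e).
  by rewrite ler_wpM2r // ler_wpDr // ler_norm.
rewrite mulrC -ltr_pdivlMr //; near: b.
by apply: (@cvgr_dist_lt _ R^o _ _ _ id); [exact: cvg_id|exact: divr_gt0].
Unshelve. all: by end_near. Qed.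

End Cone.

Lemma mdist_cayley (R : realType) (G : fg_group) (x y : cayley R G) :
  mdist x y = (word_dist (x : G) (y : G))%:R%R.
Proof. by []. Qed.

Lemma take_dist (G : sgraph) (w : seq G) (x : racg G) i j :
  (word_dist (x * (racg_word (take i w) : racg G))%g
             (x * (racg_word (take j w) : racg G))%g <= (i - j) + (j - i))%N.
Proof.
wlog ij : i j / (i <= j)%N.
  move=> wl; have [|/ltnW] := leqP i j; first exact: wl.
  by move/wl; rewrite word_dist_sym addnC.
rewrite word_dist_left /word_dist -{1}(subnKC ij) takeD racg_wordM mulKg.
apply: leq_trans (racg_length_le _) _.
by apply: leq_trans (leq_addl _ _); rewrite size_take_min geq_minl.
Qed.

Lemma truncn_dist (R : realType) (a b : R) :
  (((Num.truncn a - Num.truncn b) + (Num.truncn b - Num.truncn a))%:R <= `|a - b| + 1)%R.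
Proof.
wlog ab : a b / (a <= b)%R.
  move=> wl; have [|/ltW] := leP a b; first exact: wl.
  by move/wl; rewrite addnC distrC.
have tab := le_truncn ab; have -> : (Num.truncn a - Num.truncn b = 0)%N by lia.
rewrite add0n natrB // distrC ger0_norm ?subr_ge0 //.
have := truncnS_gt a; rewrite -addn1 natrD {tab}.
have [b0|b0] := leP 0%R b; first by have /andP[] := truncn_itv b0; lra.
have -> : Num.truncn b = 0%N by rewrite truncn_floor leNgt b0.
have -> : Num.truncn a = 0%N by rewrite truncn_floor leNgt (le_lt_trans ab b0).
by rewrite mulr0n; lra.
Qed.

Section Move.
Local Open Scope ring_scope.
Local Open Scope classical_set_scope.
Variables (R : realType) (G : sgraph).
Local Notation W := (racg G).
Local Notation X := (cayley R W).
Variable D : cone_data X.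
Local Notation omega := (cone_filter D).
Local Notation s := (cone_scale D).
Variables (S T : {set G}) (x y p : cone_seq D).
Hypothesis ST : [disjoint S & T]%B.
Hypothesis xyS : forall n, parabolic S ((val x n : W)^-1 * (val y n : W))%g.
Variable eps : R.
Hypothesis eps0 : 0 < eps.
Hypothesis far : \forall n \near omega,
  eps * s n <= (word_length (retract T ((val x n : W)^-1 * (val p n : W))%g))%:R.

(** If only letters of [S] are needed to go from [x n] to [y n], then the paths
    along these letters limit to a Lipschitz path in the cone, along which the
    projection to the [T]-coordinate is constant; it never comes near [p]. *)
Lemma move_connected : exists E : set (asymptotic_cone D),
  [/\ connected E, E (cone_class x), E (cone_class y) & ~ E (cone_class p)].
Proof.
pose w n := projT1 (cid (parabolic_word (xyS n))).
have wP n : [/\ racg_word (w n) = ((val x n : W)^-1 * (val y n : W))%g, all (mem S) (w n)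
    & size (w n) = word_dist (val x n : W) (val y n : W)].
  by rewrite /w; case: cid.
pose g (t : R) n : X := ((val x n : W) *
  (racg_word (take (Num.truncn (t * (size (w n))%:R)) (w n)) : W))%g.
have g0 : g 0 = val x.
  by apply/funext => n; rewrite /g mul0r truncn0 take0 mulg1.
have g1 : g 1 = val y.
  apply/funext => n; rewrite /g mul1r natrK take_size.
  by have [-> _ _] := wP n; rewrite mulVKg.
have [M xyM] := rescaled_near_le x y.
have sE n : (size (w n))%:R = rescaled D (val x) (val y) n * s n.
  have [_ _ ->] := wP n; rewrite /rescaled mdist_cayley.
  by rewrite mulfVK // gt_eqF // cone_scale_gt0.
have gdist t u n : rescaled D (g t) (g u) n
    <= `|t - u| * rescaled D (val x) (val y) n + (s n)^-1.
  rewrite /rescaled mdist_cayley ler_pdivrMr ?cone_scale_gt0 //.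
  apply: le_trans (_ : (_ : nat)%:R <= _).
    by rewrite ler_nat; apply: take_dist.
  apply: le_trans (truncn_dist _ _) _.
  rewrite -mulrBl normrM normr_nat sE.
  by rewrite mulrDl mulVf ?gt_eqF ?cone_scale_gt0 // mulrA.
have sinv e : 0 < e -> \forall n \near omega, (s n)^-1 <= e.
  move=> e0; near=> n; rewrite -[e]invrK lef_pV2 ?posrE ?invr_gt0 ?cone_scale_gt0 //.
  near: n; exact: scale_near_ge.
have g_seq t : `[< exists M, \forall n \near omega,
    rescaled D (g t) (cone_base D) n <= M >].
  apply: (@cone_seq_near _ _ _ x _ (`|t| * M + 1)); near=> n.
  rewrite -g0; apply: le_trans (gdist _ _ _) _.
  rewrite sub0r normrN lerD ?ler_wpM2l //; first by near: n.
  by near: n; apply: sinv.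
pose f t := cone_class (exist _ (g t) (g_seq t) : cone_seq D).
have fM t u : mdist (f t) (f u) <= M * `|t - u|.
  rewrite mdist_cone_class; apply/ler_addgt0Pl => e e0; apply: cone_dist_le.
  near=> n; rewrite /=; apply: le_trans (gdist _ _ _) _.
  rewrite addrC lerD //; first by near: n; apply: sinv.
  by rewrite mulrC ler_wpM2r //; near: n.
exists (f @` `[0, 1]); split.
- apply: connected_continuous_connected; first exact: segment_connected.
  exact/continuous_subspaceT/(lipschitz_continuous fM).
- exists 0; first by rewrite /= in_itv /= lexx ler01.
  by rewrite /f; congr cone_class; apply: val_inj; rewrite /= g0.
- exists 1; first by rewrite /= in_itv /= lexx ler01.
  by rewrite /f; congr cone_class; apply: val_inj; rewrite /= g1.
- move=> [t _ ftp]; have := mdistxx (cone_class p); rewrite -{1}ftp mdist_cone_class.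
  suff : eps <= cone_dist (exist _ (g t) (g_seq t) : cone_seq D) p.
    by move=> + d0; rewrite d0 leNgt eps0.
  apply: cone_dist_ge; near=> n; rewrite /= /rescaled mdist_cayley.
  rewrite ler_pdivlMr ?cone_scale_gt0 //.
  apply: (@le_trans _ _
    (word_length (retract T ((val x n : W)^-1 * (val p n : W))%g))%:R).
    by near: n.
  rewrite ler_nat /word_dist /g; apply: leq_trans (retract_length T _).
  set v := take _ _; rewrite invgM -mulgA.
  move: (_^-1 * val p n)%g => z; rewrite retractM retractV.
  suff -> : retract T (racg_word v) = 1%g by rewrite invg1 mul1g.
  have [_ /allP wS _] := wP n.
  have <- : retract S (racg_word v) = racg_word v.
    by apply: word_parabolic; apply/allP => a /mem_take/wS.
  by rewrite retract_disjoint // disjoint_sym.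
Unshelve. all: by end_near. Qed.

End Move.

(** * Products of infinite groups are wide *)

Section Detour.
Local Open Scope ring_scope.
Local Open Scope classical_set_scope.
Variables (R : realType) (G : sgraph).
Local Notation W := (racg G).
Local Notation X := (cayley R W).
Variable D : cone_data X.
Local Notation omega := (cone_filter D).
Local Notation s := (cone_scale D).

(** The decomposition of a product, expressed with the two retractions. *)
Definition complementary (S T : {set G}) :=
  forall z : W, z = (retract S z * retract T z)%g.

Lemma complementary_comm (S T : {set G}) : {in S & T, forall a b, adj a b} ->
  complementary S T -> complementary T S.
Proof.
move=> ST cST z; rewrite {1}[z]cST; apply: (parabolic_comm ST);
  rewrite /parabolic /= retractI; by rewrite finset.setIid.
Qed.

Lemma complementary_length (S T : {set G}) (z : W) : complementary S T ->
  (word_length z <= word_length (retract S z) + word_length (retract T z))%N.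
Proof. by move=> cST; rewrite {1}[z]cST word_lengthM. Qed.

(** In a product, a point [x] whose [T]-coordinate differs from that of [p] is
    joined to [q], whose [S]-coordinate differs from that of [p], by moving the
    [S]-coordinate first and the [T]-coordinate next. *)
Lemma detour (S T : {set G}) (x q p : cone_seq D) (eps : R) :
  [disjoint S & T]%B -> complementary S T -> 0 < eps ->
  (\forall n \near omega,
     eps * s n <= (word_length (retract T ((val x n : W)^-1 * (val p n : W))%g))%:R) ->
  (\forall n \near omega,
     s n <= (word_length (retract S ((val q n : W)^-1 * (val p n : W))%g))%:R) ->
  exists E : set (asymptotic_cone D),
    [/\ connected E, E (cone_class x), E (cone_class q) & ~ E (cone_class p)].
Proof.
move=> ST cST eps0 farx farq.
pose z n : X := ((val x n : W) * retract S ((val x n : W)^-1 * (val q n : W)))%g.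
have [M xqM] := rescaled_near_le x q.
have z_seq : `[< exists M, \forall n \near omega, rescaled D z (cone_base D) n <= M >].
  apply: (@cone_seq_near _ _ _ x _ M); near=> n.
  apply: (@le_trans _ _ (rescaled D (val x) (val q) n)); last by near: n.
  rewrite /rescaled ler_pM2r ?invr_gt0 ?cone_scale_gt0 // !mdist_cayley ler_nat.
  by rewrite {1}/word_dist mulKg retract_length.
pose z' : cone_seq D := exist _ z z_seq.
have [|E1 [cE1 E1x E1z nE1p]] := @move_connected R G D S T x z' p ST _ eps eps0 farx.
  by move=> n; rewrite /= /z mulKg /parabolic /= retractI finset.setIid.
have zq n : ((z n : W)^-1 * (val q n : W))%g
    = retract T ((val x n : W)^-1 * (val q n : W))%g.
  rewrite /z invgM -mulgA; move: (_^-1 * (_ : W))%g => v.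
  by rewrite {2}[v]cST mulKg.
have TS : [disjoint T & S]%B by rewrite disjoint_sym.
have [||E2 [cE2 E2z E2q nE2p]] := @move_connected R G D T S z' q p TS _ 1 ltr01.
- by move=> n; rewrite /= zq /parabolic /= retractI finset.setIid.
- near=> n; rewrite mul1r /=.
  have -> : ((z n : W)^-1 * (val p n : W) =
    ((z n : W)^-1 * (val q n : W)) * ((val q n : W)^-1 * (val p n : W)))%g.
    by rewrite -mulgA mulVKg.
  rewrite retractM zq retract_disjoint // mul1g; near: n; exact: farq.
exists (E1 `|` E2); split; [|by left|by right|by case].
by apply: connectedU => //; exists (cone_class z').
Unshelve. all: by end_near. Qed.

End Detour.

Section Wide.
Local Open Scope ring_scope.
Local Open Scope classical_set_scope.
Variables (R : realType) (G : sgraph) (A B : {set G}).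
Local Notation W := (racg G).
Local Notation X := (cayley R W).
Hypothesis ABT : (A :|: B)%SET = [set: G]%SET.
Hypothesis AB : {in A & B, forall a b, adj a b}.

Lemma join_disjoint : [disjoint A & B]%B.
Proof.
apply/pred0P => a /=; apply/negP => /andP[aA aB].
by have := AB aA aB; rewrite adj_irr.
Qed.

Lemma join_complementary : complementary A B.
Proof.
move=> z; have [w ->] := racg_word_surj z.
have wAB : all (mem (A :|: B)%SET) w by apply/allP => a _; rewrite /= ABT finset.in_setT.
elim: w wAB => [|a w IH] /=.
  by move=> _; rewrite racg_word0 !(homg1 (@retractM _ _)) mulg1.
case/andP=> aAB wAB; rewrite racg_wordS !retractM {1}IH //.
case: (boolP (a \in A)) => aA.
  have aB : a \notin B by apply/negP => aB; have := AB aA aB; rewrite adj_irr.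
  by rewrite !retract_gen aA (negbTE aB) mul1g mulgA.
have aB : a \in B by move: aAB; rewrite inE (negbTE aA).
rewrite !retract_gen (negbTE aA) aB mul1g !mulgA; congr (_ * _)%g.
apply/esym/(parabolic_comm AB); first by rewrite /parabolic /= retractI finset.setIid.
by rewrite /parabolic /= retract_gen aB.
Qed.

Variables (a a' b b' : G).
Hypotheses (aA : a \in A) (a'A : a' \in A) (aa' : nonadj a a').
Hypotheses (bB : b \in B) (b'B : b' \in B) (bb' : nonadj b b').

(** All points other than [p] can be joined to one point [q], whose two
    coordinates are both at distance of the order of the scale from those of [p]. *)
Lemma no_cut_point (D : cone_data X) (p : asymptotic_cone D) : ~ cut_point p.
Proof.
apply; have [p' ->] := cone_class_surj p.
have omegaU := cone_ultra D.
pose m n := (Num.truncn (cone_scale D n)).+1.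
pose za n : W := (zigzag a a' ^+ m n)%g; pose zb n : W := (zigzag b b' ^+ m n)%g.
pose q n : X := ((val p' n : W) * (za n * zb n))%g.
have sm n : cone_scale D n <= (m n)%:R by exact/ltW/truncnS_gt.
have disj := join_disjoint; have disj' : [disjoint B & A]%B by rewrite disjoint_sym.
have compl := join_complementary; have compl' := complementary_comm AB compl.
have zaA n : parabolic A (za n) by apply: parabolic_zigzag.
have zbB n : parabolic B (zb n) by apply: parabolic_zigzag.
have q_seq : `[< exists M, \forall n \near cone_filter D,
    rescaled D q (cone_base D) n <= M >].
  apply: (@cone_seq_near _ _ _ p' _ 8); near=> n.
  rewrite /rescaled ler_pdivrMr ?cone_scale_gt0 // mdist_cayley /word_dist mulKg.
  have s1 : 1 <= cone_scale D n by near: n; exact: scale_near_ge.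
  apply: (@le_trans _ _ (4 * (m n))%:R).
    rewrite ler_nat; apply: leq_trans (word_lengthM _ _) _.
    have /andP[_] := zigzag_length aa' (m n).
    have /andP[_] := zigzag_length bb' (m n).
    rewrite -/(za n) -/(zb n); lia.
  rewrite natrM /m -addn1 natrD.
  have /andP[+ _] := truncn_itv (le_trans ler01 s1); lra.
pose q' : cone_seq D := exist _ q q_seq.
have qp n : ((q n : W)^-1 * (val p' n : W) = (za n * zb n)^-1)%g.
  by rewrite /q invgM -mulgA mulVg mulg1.
have farA : \forall n \near cone_filter D, cone_scale D n <=
    (word_length (retract A ((val q' n : W)^-1 * (val p' n : W))%g))%:R.
  apply: nearW => n; rewrite /= qp retractV retractM zaA -zbB retract_disjoint //.
  rewrite mulg1 word_lengthV; apply: le_trans (sm n) _; rewrite ler_nat.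
  by have /andP[] := zigzag_length aa' (m n).
have farB : \forall n \near cone_filter D, cone_scale D n <=
    (word_length (retract B ((val q' n : W)^-1 * (val p' n : W))%g))%:R.
  apply: nearW => n; rewrite /= qp retractV retractM zbB -zaA retract_disjoint //.
  rewrite mul1g word_lengthV; apply: le_trans (sm n) _; rewrite ler_nat.
  by have /andP[] := zigzag_length bb' (m n).
have joinq x : x != cone_class p' -> exists E : set (asymptotic_cone D),
    [/\ connected E, E x, E (cone_class q') & ~ E (cone_class p')].
  have [x' ->] := cone_class_surj x.
  rewrite -mdist_gt0 mdist_cone_class => d0; set d := cone_dist _ _ in d0.
  have d2 : d / 2 < d by rewrite ltr_pdivrMr // ltr_pMr // ltr1n.
  have far := rescaled_near_gt d2.
  (* The ultrafilter decides which of the two coordinates of [x] differs from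
     that of [p]; their distances add up to at least half of [d]. *)
  pose FA := [set n | d / 4 * cone_scale D n <=
    (word_length (retract A ((val x' n : W)^-1 * (val p' n : W))%g))%:R].
  have d4 : 0 < d / 4 by rewrite divr_gt0.
  have [nearA|nearB] := in_ultra_setVsetC FA omegaU.
    exact: (detour disj' compl' d4 nearA farB).
  apply: (detour disj compl d4 _ farA).
  near=> n.
  have : d / 2 < rescaled D (val x') (val p') n by near: n.
  have : (~` FA) n by near: n.
  rewrite /FA /= => /negP; rewrite -ltNge.
  rewrite /rescaled ltr_pdivlMr ?cone_scale_gt0 // mdist_cayley /word_dist.
  have := complementary_length ((val x' n : W)^-1 * (val p' n : W))%g compl.
  rewrite -(ler_nat R) natrD; move: (_^-1 * _)%g => v.
  by rewrite (_ : d / 2 = d / 4 + d / 4); [lra|field].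
have -> : [set~ cone_class p'] = \bigcup_(x in [set x | x != cone_class p'])
    (if pselect (x != cone_class p') is left xp then projT1 (cid (joinq x xp)) else set0).
  apply/seteqP; split=> x.
    move=> /eqP xp; exists x => //; case: pselect => // xp'.
    by case: cid => E [].
  move=> [y /= yp]; case: pselect => // yp'; case: cid => E [_ _ _ nEp] /= Ex xp.
  by apply: nEp; rewrite -xp.
apply: bigcup_connected.
  exists (cone_class q') => y /= yp; case: pselect => // yp'; by case: cid => E [].
by move=> y /= yp; case: pselect => // yp'; case: cid => E [].
Unshelve. all: by end_near. Qed.

End Wide.

Section Line.
Local Open Scope ring_scope.
Variables (G : sgraph) (a b : G).
Hypothesis ab : nonadj a b.
Local Notation W := (racg G).
Local Notation z := (zigzag a b).

(** The integral powers of the translation, which trace a bi-infinite line. *)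
Definition zigzag_int (n : int) : W :=
  match n with Posz m => (z ^+ m)%g | Negz m => (z^-1 ^+ m.+1)%g end.

Lemma zigzag_intS n : zigzag_int (n + 1) = (zigzag_int n * z)%g.
Proof.
case: n => [m|[|m]]; first by rewrite -PoszD addn1 /= expgSr.
  by rewrite /= expg1 mulVg.
rewrite (_ : Negz m.+1 + 1 = Negz m) /=; last by rewrite !NegzE; lia.
by rewrite [in RHS]expgSr mulgVK.
Qed.

Lemma line_move_zigzag_int n (x : W) :
  line_move a b (zigzag_int n * x)%g = line_move a b x - n.
Proof.
have pos m (y : W) : line_move a b (z ^+ m * y)%g = line_move a b y - m%:Z.
  elim: m y => [|m IH] y; first by rewrite expg0 mul1g subr0.
  by rewrite expgS -mulgA line_move_zigzagM // IH; lia.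
case: n => m /=; first exact: pos.
rewrite expVgn; have := pos m.+1 ((z ^+ m.+1)^-1 * x)%g.
by rewrite mulVKg => ->; rewrite NegzE opprK subrK.
Qed.

Lemma zigzag_int_dist (m n : int) :
  (absz (m - n)%R <= word_dist (zigzag_int m) (zigzag_int n) <= 2 * absz (m - n)%R)%N.
Proof.
apply/andP; split.
  have := line_move_length ab ((zigzag_int m)^-1 * zigzag_int n)%g.
  have := line_move_zigzag_int m ((zigzag_int m)^-1 * zigzag_int n)%g.
  have := line_move_zigzag_int n 1%g.
  have -> : line_move a b 1%g = 0 by rewrite -racg_word0 line_moveE.
  rewrite mulVKg mulg1 /word_dist => ->; lia.
wlog mn : m n / m <= n.
  move=> wl; have [|/ltW] := leP m n; first exact: wl.
  by move/wl; rewrite word_dist_sym distnC.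
have [d ->] : exists d : nat, n = m + d%:Z by exists (absz (m - n)%R); lia.
have -> : absz (m - (m + d%:Z))%R = d by lia.
elim: d => [|d IH]; first by rewrite addr0 word_distxx.
apply: leq_trans (word_dist_triangle (zigzag_int (m + d%:Z)) _ _) _.
rewrite mulnS addnC leq_add //.
have -> : m + d.+1%:Z = m + d%:Z + 1 by lia.
rewrite zigzag_intS /word_dist mulKg.
by have /andP[_] := zigzag_length ab 1; rewrite expg1.
Qed.

Lemma floor_dist (R : realType) (t u : R) :
  `|t - u| - 1 <= (absz (Num.floor t - Num.floor u)%R)%:R <= `|t - u| + 1.
Proof.
have -> : (absz (Num.floor t - Num.floor u)%R)%:R
    = `|(Num.floor t)%:~R - (Num.floor u)%:~R| :> R.
  by rewrite -intrB -intr_norm pmulrn abszE.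
have /andP[t1 t2] := floor_itv t; have /andP[u1 u2] := floor_itv u.
move: t1 t2 u1 u2; rewrite !intrD; set f : R := _%:~R; set g : R := (Num.floor u)%:~R.
move=> t1 t2 u1 u2; apply/andP; split.
  by rewrite lerBlDr ler_norml; have [] := ger0P (f - g); lra.
by rewrite ler_norml; have [] := ger0P (t - u); lra.
Qed.

End Line.

Section WideJoin.
Variables (R : realType) (G : sgraph).
Local Open Scope ring_scope.

Lemma join_wide : nonadj_join [set: G]%SET -> wide R (racg G).
Proof.
move=> /nonadj_joinP[A [B [/esym ABT AB]]].
move=> /has_nonadjP[a [a' [aA a'A aa']]] /has_nonadjP[b [b' [bB b'B bb']]].
split=> [D p|]; first exact: (no_cut_point ABT AB aA a'A aa' bB b'B bb').
exists 2, 0; split=> [|x]; first by rewrite ler1n.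
exists (fun t => ((x : racg G) * zigzag_int a a' (Num.floor t))%g : cayley R (racg G)).
  move=> t u _ _; rewrite mdist_cayley word_dist_left.
  have /andP[] := zigzag_int_dist aa' (Num.floor t) (Num.floor u).
  have /andP[] := floor_dist t u.
  rewrite -!(ler_nat R) natrM; move: (_%:R) (word_dist _ _)%:R => d e.
  have := normr_ge0 (t - u); move: `|t - u| => r; lra.
by exists 0; rewrite mdist_cayley floor0 /= expg0 mulg1 word_distxx.
Qed.

End WideJoin.

(** * Convexity of special subgroups and of their conjugates *)

Lemma word_dist_right (G : fg_group) (x y g : G) :
  (word_dist (x * g)%g (y * g)%g <= word_dist x y + (word_length g + word_length g))%N.
Proof.
rewrite /word_dist invgM -mulgA (mulgA x^-1%g).
apply: leq_trans (word_lengthM _ _) _; rewrite word_lengthV addnCA leq_add2l.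
exact: word_lengthM.
Qed.

Section Convexity.
Local Open Scope ring_scope.
Local Open Scope classical_set_scope.
Variables (R : realType) (G : sgraph).
Local Notation W := (racg G).
Local Notation X := (cayley R W).

Lemma nbhd_self (C : R) (Y : set X) x : 0 <= C -> Y x -> nbhd C Y x.
Proof. by move=> C0 Yx; exists x; rewrite // mdistxx. Qed.

Lemma truncn_distE (t u : R) : 0 <= t -> 0 <= u ->
  `|t - u| - 1 <= `|(Num.truncn t)%:R - (Num.truncn u)%:R| <= `|t - u| + 1.
Proof.
move=> t0 u0; have /andP[t1 t2] := truncn_itv t0; have /andP[u1 u2] := truncn_itv u0.
move: t2 u2; rewrite -!natr1; set f : R := _%:R; set g : R := (Num.truncn u)%:R.
move=> t2 u2; apply/andP; split.
  by rewrite lerBlDr ler_norml; have [] := ger0P (f - g); lra.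
by rewrite ler_norml; have [] := ger0P (t - u); lra.
Qed.

Lemma parabolic_prefix (S : {set G}) (x : W) (w : seq G) i :
  parabolic S x -> all (mem S) w -> parabolic S (x * racg_word (take i w))%g.
Proof.
move=> xS /allP wS; rewrite /parabolic /= retractM xS; congr (_ * _)%g.
by apply: word_parabolic; apply/allP => a /mem_take/wS.
Qed.

(** Rounding the parameter to an integer costs 1 and the map [f] costs 2, whence
    the constant 3, which serves for all the networks below. *)
Lemma image_quasi_convex (S : {set G}) (f : W -> W) :
  (forall x y, word_dist (f x) (f y) <= word_dist x y + 2 /\
               word_dist x y <= word_dist (f x) (f y) + 2)%N ->
  quasi_convex 3 (f @` parabolic S : set X).
Proof.
move=> f2 _ _ [x xS <-] [y yS <-].
have xyS : parabolic S (x^-1 * y)%g by rewrite /parabolic /= retractM retractV xS yS.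
have [w [wE wS sw]] := parabolic_word xyS.
have g_w : word_length (racg_word w : W) = size w by rewrite wE sw.
pose c (t : R) : X := f (x * racg_word (take (Num.truncn t) w))%g.
exists 0, (size w)%:R, c; split.
- by rewrite ler0n.
- by rewrite /c truncn0 take0 racg_word0 mulg1.
- by rewrite /c natrK take_size wE mulVKg.
- move=> t u /=; rewrite !in_itv /= => /andP[t0 tw] /andP[u0 uw].
  have size_le (v : R) : 0 <= v -> v <= (size w)%:R -> (Num.truncn v <= size w)%N.
    by move=> v0 vw; rewrite -(ler_nat R); apply: le_trans vw; rewrite truncn_le.
  have dE : (word_dist (x * racg_word (take (Num.truncn t) w) : W)%g
      (x * racg_word (take (Num.truncn u) w) : W)%g)%:R
      = `|(Num.truncn t)%:R - (Num.truncn u)%:R| :> R.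
    rewrite word_dist_left.
    wlog tu : t u t0 tw u0 uw / (Num.truncn t <= Num.truncn u)%N.
      move=> wl; have [|/ltnW] := leqP (Num.truncn t) (Num.truncn u); first exact: wl.
      by move/wl; rewrite word_dist_sym distrC; apply.
    rewrite geodesic_take ?tu ?size_le // natrB //.
    by rewrite distrC ger0_norm // subr_ge0 ler_nat.
  have [] := f2 (x * racg_word (take (Num.truncn t) w))%g
    (x * racg_word (take (Num.truncn u) w))%g.
  rewrite -!(ler_nat R) !natrD dE mdist_cayley -/(c t) -/(c u).
  have /andP[] := truncn_distE t0 u0.
  move: (word_dist _ _)%:R `|_%:R - _| => d e.
  have := normr_ge0 (t - u); move: `|t - u| => r; lra.
- move=> _ [t _ <-]; apply: nbhd_self => //.
  by exists (x * racg_word (take (Num.truncn t) w))%g => //; apply: parabolic_prefix.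
Qed.

Lemma parabolic_quasi_convex (S : {set G}) : quasi_convex 3 (parabolic S : set X).
Proof.
have := @image_quasi_convex S id; rewrite image_id; apply=> x y; split; exact: leq_addr.
Qed.

Definition gen_conj (k : G) (x : W) : W := (racg_gen k * x * racg_gen k)%g.

Lemma gen_conj_dist k x y :
  (word_dist (gen_conj k x) (gen_conj k y) <= word_dist x y + 2 /\
   word_dist x y <= word_dist (gen_conj k x) (gen_conj k y) + 2)%N.
Proof.
have k1 := racg_length_gen k; rewrite /gen_conj -!mulgA !word_dist_left; split.
  by apply: leq_trans (word_dist_right _ _ _) _; rewrite leq_add2l (leq_add k1 k1).
have := word_dist_right (x * racg_gen k)%g (y * racg_gen k)%g (racg_gen k)^-1%g.
rewrite !mulgK => /leq_trans; apply.
by rewrite leq_add2l word_lengthV (leq_add k1 k1).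
Qed.

Lemma parabolic_path_connected (S : {set G}) :
  C_path_connected 3 (parabolic S : set X).
Proof.
move=> x y xS yS.
have xyS : parabolic S ((x : W)^-1 * (y : W))%g.
  by rewrite /parabolic /= retractM retractV xS yS.
have [w [wE wS sw]] := parabolic_word xyS.
have g_w : word_length (racg_word w : W) = size w by rewrite wE sw.
exists (size w), (fun i => ((x : W) * racg_word (take i w))%g); split.
- by rewrite take0 racg_word0 mulg1.
- by rewrite take_size wE mulVKg.
- move=> i iw; rewrite mdist_cayley word_dist_left geodesic_take ?leqnSn //.
  by rewrite subSnn.
- by move=> i _; apply: nbhd_self => //; apply: parabolic_prefix.
Qed.

End Convexity.

(** * Tight networks *)

Section Thick.
Variable R : realType.
Local Open Scope classical_set_scope.

(** Quantifying over all graphs [K] identified with [A], and not only over the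
    induced subgraph, lets the property be pulled back to subgraphs without
    isomorphisms between nested induced subgraphs. *)
Definition thick_on (G : sgraph) n (A : {set G}) :=
  forall (K : sgraph) (e : K -> G), sgraph_embedding e ->
    [set e a | a in K]%SET = A -> alg_thick R n (racg K).

Lemma sgraph_embedding_comp (K L G : sgraph) (f : K -> L) (e : L -> G) :
  sgraph_embedding f -> sgraph_embedding e -> sgraph_embedding (e \o f).
Proof.
by move=> [fI fE] [eI eE]; split=> [|a b]; [apply: inj_comp|rewrite /= eE fE].
Qed.

Lemma thick_on_preim (K G : sgraph) (e : K -> G) n (B : {set G}) :
  sgraph_embedding e -> B \subset [set e a | a in K]%SET ->
  thick_on n B -> thick_on n (e @^-1: B).
Proof.
move=> eE Be Bn L f fE fB; apply: (Bn L (e \o f)); first exact: sgraph_embedding_comp.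
apply/setP => b; apply/imsetP/idP => [[a _ ->]|bB].
  by have : f a \in e @^-1: B; [rewrite -fB imset_f|rewrite inE].
have /imsetP[a _ ba] := fintype.subsetP Be _ bB.
have : a \in e @^-1: B by rewrite inE -ba.
by rewrite -fB => /imsetP[c _ ac]; exists c; rewrite // ba ac.
Qed.

Section Induced.
Variables (G : sgraph) (B : {set G}).
Definition induced_adj : rel {x : G | x \in B} := fun x y => adj (val x) (val y).
Lemma induced_sym : symmetric induced_adj.
Proof. by move=> x y; apply: adj_sym. Qed.
Lemma induced_irr : irreflexive induced_adj.
Proof. by move=> x; apply: adj_irr. Qed.
Definition induced := SGraph induced_sym induced_irr.
Definition induced_val (x : induced) : G := val x.
Lemma induced_embedding : sgraph_embedding induced_val.
Proof. by split=> [|//]; apply: val_inj. Qed.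
Lemma induced_image : [set induced_val a | a in induced]%SET = B.
Proof.
apply/setP => b; apply/imsetP/idP => [[a _ ->]|bB]; first exact: valP.
by exists (Sub b bB : {x : G | x \in B}).
Qed.
End Induced.

Lemma thick_on_embeds (G : sgraph) n (B : {set G}) : thick_on n B ->
  exists (K : fg_group) (f : K -> racg G), embeds_onto f (parabolic B) /\ alg_thick R n K.
Proof.
move=> Bn; have eE := induced_embedding B.
exists (racg (induced B)), (include (@induced_val _ B)); split.
  split; [exact: includeM|exact: can_inj (includeK eE)|].
  by rewrite range_include // induced_image.
exact: Bn eE (induced_image B).
Qed.

Lemma finite_index_generated (G : sgraph) (P : set (racg G)) :
  generated P = setT -> finite_index (generated P).
Proof.
move=> ->; exists [set 1%g]; first exact: finite_set1.
by move=> x; exists 1%g, x; split; rewrite ?mul1g.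
Qed.

Lemma generated_gens (G : sgraph) (P : set (racg G)) :
  (forall s, P (racg_gen s)) -> generated P = setT.
Proof.
move=> gP; apply/seteqP; split=> // x _ H [Hg PH].
have : generated (range (@racg_gen G)) x by rewrite racg_gens_generate.
by apply; split=> // _ [s _ <-]; apply/PH/gP.
Qed.

(** The network of the special subgroups of the members of [F]: consecutive
    members of a chain share a non-adjacent pair, so that the intersection, a
    special subgroup, is infinite; and all generators are covered. *)
Lemma union_thick (G : sgraph) n (F : {set {set G}}) :
  {in F, forall B, thick_on n B} -> chain_connected F -> finset.cover F = [set: G]%SET ->
  alg_thick R n.+1 (racg G).
Proof.
move=> Fn Fc FT; exists 3%R, (@parabolic G @` [set` F]); split=> //.
- by apply: finite_image.
- split.
  + by move=> _ [B _ <-]; apply: parabolic_subgroup.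
  + by move=> _ [B _ <-]; apply: parabolic_quasi_convex.
  + apply/finite_index_generated/generated_gens => s.
    have /finset.bigcupP[B BF sB] : s \in finset.cover F by rewrite FT finset.in_setT.
    by exists (parabolic B); [exists B|rewrite /parabolic /= retract_gen sB].
  + move=> _ _ [B /= BF <-] [B' /= B'F <-].
    have /connectP[p pth ->] := Fc _ _ BF B'F.
    exists (size p), (fun i => parabolic (nth B (B :: p) i)); split=> //.
    * by rewrite (last_nth B).
    * move=> i ip; exists (nth B (B :: p) i) => //=.
      case: i ip => [|i] //= ip.
      have := pathP B pth i ip; by case/and3P.
    * move=> i ip; have /and3P[_ _ /has_nonadjP[s [t [sI tI st]]]] := pathP B pth i ip.
      rewrite parabolicI; split; last exact: parabolic_path_connected.
      exact: parabolic_infinite st _ sI tI.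
- by move=> _ [B /= BF <-]; apply/thick_on_embeds/Fn.
Qed.

(** The retraction onto [B] kills [k], so it maps [k y k] to [y]: an element of
    the intersection is its own conjugate, that is, it commutes with [k]. *)
Lemma parabolic_conj (G : sgraph) (k : G) (B : {set G}) : k \notin B ->
  parabolic B `&` (gen_conj k @` parabolic B) = parabolic [set s in B | adj k s]%SET.
Proof.
move=> kB.
apply/seteqP; split=> [x [xB [y yB xE]]|x xN].
  apply: parabolic_centralizer => //.
  have yx : y = x.
    move: xB; rewrite -xE /parabolic /gen_conj /= !retractM retract_gen (negbTE kB).
    by rewrite mul1g mulg1 yB.
  by rewrite -{2}xE yx /gen_conj -mulgA racg_genK mulg1.
have xB : parabolic B x.
  have [w [<- /allP wN _]] := parabolic_word xN.
  by apply: word_parabolic; apply/allP => s /wN /setIdP[].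
split=> //; exists x => //; rewrite /gen_conj.
have -> : (racg_gen k * x = x * racg_gen k :> racg G)%g.
  apply: (parabolic_comm (S := [set k]%SET) (T := [set s in B | adj k s]%SET)) => //.
    by move=> s t; rewrite !inE => /eqP-> /andP[].
  by rewrite /parabolic /= retract_gen inE eqxx.
by rewrite -mulgA racg_genK mulg1.
Qed.

(** The network of the special subgroup of [B] and its conjugate by [k]. They
    generate the subgroup of index 2 of the elements of even length in [k], and
    meet in the special subgroup of the neighbours of [k] in [B]. *)
Lemma cone_thick (G : sgraph) n (B : {set G}) s t k :
  s \in B -> t \in B -> nonadj s t -> adj s k -> adj t k -> k \notin B ->
  (k |: B)%SET = [set: G]%SET -> thick_on n B -> alg_thick R n.+1 (racg G).
Proof.
move=> sB tB st sk tk kB kBT Bn.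
have conjM x y : gen_conj k (x * y)%g = (gen_conj k x * gen_conj k y)%g.
  rewrite /gen_conj !mulgA -(mulgA (_ * x)%g (racg_gen k) (racg_gen k)).
  by rewrite racg_genK mulg1.
have conjK : involutive (@gen_conj G k).
  by move=> x; rewrite /gen_conj !mulgA racg_genK mul1g -mulgA racg_genK mulg1.
pose H1 := parabolic B; pose H2 : set (racg G) := gen_conj k @` parabolic B.
exists 3%R, [set H1; H2]; split=> //.
- have meet : infinite_set (H1 `&` H2) /\
      C_path_connected 3 (H1 `&` H2 : set (cayley R (racg G))).
    rewrite /H1 /H2 parabolic_conj //; split; last exact: parabolic_path_connected.
    by apply: (parabolic_infinite st); rewrite inE ?sB ?tB adj_sym.
  have [H11 H1d] := parabolic_subgroup B.
  split.
  + move=> _ [->|->]; first exact: parabolic_subgroup.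
    split; first by exists 1%g; rewrite // /gen_conj mulg1 racg_genK.
    move=> _ _ [x xB <-] [y yB <-]; exists (x / y)%g; first exact: H1d.
    by rewrite conjM (homgV conjM).
  + move=> _ [->|->]; first exact: parabolic_quasi_convex.
    exact/image_quasi_convex/gen_conj_dist.
  + set N := generated _.
    have [N1 Nd] : is_subgroup N.
      split=> [H [[]]//|x y xN yN H [HS HH]].
      by apply: HS.2; [apply: xN|apply: yN].
    have NM x y : N x -> N y -> N (x * y)%g.
      move=> xN yN; rewrite -[y]invgK; apply: (Nd) => //.
      by rewrite -[y^-1%g]mul1g; apply: Nd.
    have BN x : H1 x -> N x.
      by move=> xB H [_ HH]; apply: HH; exists H1; [left|].
    have BkN x : H2 x -> N x.
      by move=> xB H [_ HH]; apply: HH; exists H2; [right|].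
    exists [set 1%g; racg_gen k]; first exact: finite_set2.
    move=> x; have [w ->] := racg_word_surj x; elim: w => [|a w [f [h [ff hN wE]]]].
      by exists 1%g, 1%g; split; rewrite ?mulg1 //; left.
    rewrite racg_wordS wE.
    have : a \in (k |: B)%SET by rewrite kBT finset.in_setT.
    case/setU1P => [->|aB].
      case: ff => ->; first by exists (racg_gen k), h; split; rewrite ?mul1g //; right.
      by exists 1%g, h; split; rewrite ?mulgA ?racg_genK //; left.
    have aN : H1 (racg_gen a) by rewrite /H1 /parabolic /= retract_gen aB.
    case: ff => ->.
      exists 1%g, (racg_gen a * h)%g; split; rewrite ?mul1g //; first by left.
      by apply: NM => //; apply: BN.
    exists (racg_gen k), (gen_conj k (racg_gen a) * h)%g; split.
    * by right.
    * by apply: NM => //; apply: BkN; exists (racg_gen a).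
    * by rewrite /gen_conj !mulgA racg_genK mul1g.
  + move=> H H' HH H'H.
    have [->|HH'] := pselect (H = H').
      by exists 0%N, (fun=> H'); split.
    exists 1%N, (fun i => if i is 0%N then H else H'); split=> //; first by case.
    case=> // _ /=; case: HH HH' => ->; case: H'H => -> // _.
    by rewrite [H2 `&` H1]setIC.
- have [K [f [[fM fI fB] Kn]]] := thick_on_embeds Bn.
  move=> _ [->|->]; exists K; first by exists f.
  exists (gen_conj k \o f); split=> //; split.
  + by move=> x y; rewrite /= fM conjM.
  + exact: inj_comp (inv_inj conjK) fI.
  + by rewrite /H2 -fB image_comp.
Qed.

Lemma thick_on_union (G : sgraph) n (F : {set {set G}}) :
  {in F, forall B, thick_on n B} -> chain_connected F -> thick_on n.+1 (finset.cover F).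
Proof.
move=> Fn Fc K e eE eF.
have inF B : B \in F -> B \subset [set e a | a in K]%SET.
  by move=> BF; rewrite eF; apply: finset.bigcup_sup BF.
apply: (@union_thick K n [set e @^-1: B | B : {set G} in F]%SET).
- by move=> _ /imsetP[B BF ->]; apply: thick_on_preim => //; [apply: inF|apply: Fn].
- move=> _ _ /imsetP[B BF ->] /imsetP[B' B'F ->].
  have /connectP[p] := Fc _ _ BF B'F.
  elim: p B BF => [|D p IH] B BF /=; first by move=> _ ->.
  case/andP=> /and3P[_ DF /has_nonadjP[s [t [/setIP[sB sD] /setIP[tB tD] st]]]] pth B'E.
  apply: connect_trans (IH D DF pth B'E); apply: connect_meets; try exact: imset_f.
  have /imsetP[s' _ sE] := fintype.subsetP (inF _ BF) _ sB.
  have /imsetP[t' _ tE] := fintype.subsetP (inF _ BF) _ tB.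
  apply/has_nonadjP; exists s', t'; rewrite !inE -sE -tE; split; try exact/andP.
  by move: st; rewrite /nonadj sE tE eE.2 (inj_eq eE.1).
- apply/setP => a; rewrite finset.in_setT; apply/finset.bigcupP.
  have : e a \in finset.cover F by rewrite -eF imset_f.
  by case/finset.bigcupP => B BF aB; exists (e @^-1: B); [apply: imset_f|rewrite inE].
Qed.

Lemma thick_on_cone (G : sgraph) n (B : {set G}) s t k :
  s \in B -> t \in B -> nonadj s t -> adj s k -> adj t k -> k \notin B ->
  thick_on n B -> thick_on n.+1 (k |: B)%SET.
Proof.
move=> sB tB st sk tk kB Bn K e eE eB.
have BE : B \subset [set e a | a in K]%SET by rewrite eB finset.subsetUr.
have pre a : a \in (k |: B)%SET -> exists a', a = e a'.
  by rewrite -eB => /imsetP[a' _ ->]; exists a'.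
have [s' sE] := pre s (setU1r _ sB); have [t' tE] := pre t (setU1r _ tB).
have [k' kE] := pre k (setU11 _ _); subst s t k.
apply: (@cone_thick K n (e @^-1: B) s' t' k'); rewrite ?inE -?eE.2 //.
- by move: st; rewrite /nonadj eE.2 (inj_eq eE.1).
- apply/setP => a; rewrite !inE; have : e a \in (e k' |: B)%SET by rewrite -eB imset_f.
  by rewrite !inE (inj_eq eE.1).
- exact: thick_on_preim.
Qed.

Lemma thick_on_join (G : sgraph) (M : {set G}) : nonadj_join M -> thick_on 0 M.
Proof.
move=> /nonadj_joinP[A [B [ME AB hA hB]]] K e eE eM; apply: join_wide.
have hpre (C : {set G}) : C \subset M -> has_nonadj C -> has_nonadj (e @^-1: C).
  move=> /fintype.subsetP CM /has_nonadjP[s [t [sC tC st]]].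
  have := CM s sC; have := CM t tC; rewrite -eM => /imsetP[t' _ tE] /imsetP[s' _ sE].
  apply/has_nonadjP; exists s', t'; rewrite !inE -sE -tE; split=> //.
  by move: st; rewrite /nonadj sE tE eE.2 (inj_eq eE.1).
apply/nonadj_joinP; exists (e @^-1: A), (e @^-1: B); split.
- apply/setP => a; rewrite !finset.inE -finset.in_setU -ME -eM imset_f //.
- by move=> s t; rewrite !inE -eE.2; apply: AB.
- by apply: hpre; rewrite // ME finset.subsetUl.
- by apply: hpre; rewrite // ME finset.subsetUr.
Qed.

End Thick.

Theorem theorem6p4 (R : realType) (Gamma : sgraph) (h : nat) :
  (0 < h)%N -> has_hypergraph_index Gamma h ->
  alg_thick R (2 * h - 1)%N (racg Gamma).
Proof.
move=> h0 hh; have id_emb : sgraph_embedding (@id Gamma) by split.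
suff : thick_on R (2 * h - 1) [set: Gamma]%SET.
  move/(_ Gamma id id_emb); apply; apply/setP => a.
  by rewrite finset.in_setT (imset_f id).
apply: (hypergraph_index_induction (P := fun n A => thick_on R n A)) => // {h h0 hh}.
- exact: thick_on_join.
- by move=> n F _; apply: thick_on_union.
- exact: thick_on_cone.
Qed.
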